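(* Let $\mathbf{A}$ be a finite simple non-abelian loop with identity $e$, let $V$ be the variety generated by $\mathbf{A}$, and let $W$ be the variety generated by all proper subloops of $\mathbf{A}$. (1) The free loop $\mathbf{F}$ of countable (infinite) rank in $V$ has a normal subloop $N$ and a subloop $H$ such that: (a) $N\cong(\mathbf{A}^{\mathbf{B}})^x_e$, where $\mathbf{B}$ is the countable atomless Boolean algebra and $x\in 2^\omega$; (b) $H$ is isomorphic to the free loop of countable (infinite) rank in $W$; (c) $N\cap H=\{e\}$ (the trivial subloop of $\mathbf{F}$) and $F=NH$. (2) Every countable loop $\mathbf{C}$ in $V$ is a split extension of a filtered Boolean power $(\mathbf{A}^{\mathbf{B}})^x_e$, for some Boolean algebra $\mathbf{B}$ (and some point $x$ of its Stone space), by some loop in $W$.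
   Context: Loops are regarded as algebras in the sense of universal algebra (with multiplication, left and right division and identity); every loop is a Mal'cev algebra. A loop is abelian in the sense of commutator theory iff its basic operations can be represented as affine functions over a module, i.e. iff it is an abelian group; otherwise it is non-abelian. A loop $\mathbf{C}$ is a split extension of a normal subloop $N$ by a subloop $H$ if $H$ is a transversal through the cosets of $N$ in $\mathbf{C}$. The Stone space $X$ of a Boolean algebra $\mathbf{B}$ is its set of ultrafilters with basic open sets $\{x\in X : b\in x\}$, $b\in B$. The countable atomless Boolean algebra is unique up to isomorphism and its Stone space is the Cantor space $2^\omega$. The Boolean power $\mathbf{A}^{\mathbf{B}}$ is the subalgebra of the direct power $\mathbf{A}^X$ whose elements are the continuous functions $f\colon X\to A$, where $A$ is discrete. For $x\in X$, the filtered Boolean power $(\mathbf{A}^{\mathbf{B}})^x_e$ is the subalgebra of $\mathbf{A}^{\mathbf{B}}$ with universe $\{f\in A^{\mathbf{B}} : f(x)=e\}$. *)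

(* Defs.v *)
From HB Require Import structures.
From mathcomp Require Import all_boot all_order all_algebra.
From mathcomp Require Import all_classical topology.

Set Implicit Arguments.
Unset Strict Implicit.
Unset Printing Implicit Defensive.

Import Order.Theory GRing.Theory.

Local Open Scope classical_set_scope.
Local Open Scope group_scope.

(* [ldiv x y] is x \ y and [rdiv x y] is x / y. *)
HB.mixin Record UMagma_isLoop T of UMagma T := {
  ldiv : T -> T -> T;
  rdiv : T -> T -> T;
  mul_ldiv : forall x y : T, x * ldiv x y = y;
  ldiv_mul : forall x y : T, ldiv x (x * y) = y;
  rdiv_mul : forall x y : T, rdiv x y * y = x;
  mul_rdiv : forall x y : T, rdiv (x * y) y = x
}.

#[short(type="loopType")]
HB.structure Definition Loop := {T of UMagma_isLoop T & UMagma T}.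

Definition loop_hom (L M : loopType) (f : L -> M) : Prop :=
  [/\ f 1 = 1,
      forall x y, f (x * y) = f x * f y,
      forall x y, f (ldiv x y) = ldiv (f x) (f y) &
      forall x y, f (rdiv x y) = rdiv (f x) (f y)].

Definition loop_isomorphic (L M : loopType) : Prop :=
  exists2 f : L -> M, loop_hom f & bijective f.

Definition subloop_closed (L : loopType) (S : set L) : Prop :=
  [/\ S 1,
      forall x y, S x -> S y -> S (x * y),
      forall x y, S x -> S y -> S (ldiv x y) &
      forall x y, S x -> S y -> S (rdiv x y)].

Record subloop (L : loopType) := Subloop {
  subloop_set :> set L;
  subloopP : subloop_closed subloop_set
}.

Definition subloop_type (L : loopType) (S : subloop L) : Type :=
  {x : L | x \in subloop_set S}.

Section SubloopTheory.
Context (L : loopType) (S : subloop L).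
Local Notation T := (subloop_type S).

HB.instance Definition _ := Choice.on T.

Let sub1 : 1 \in subloop_set S.
Proof. by apply/mem_set; case: (subloopP S). Qed.

Let subM (x y : T) : val x * val y \in subloop_set S.
Proof. by apply/mem_set; case: (subloopP S) => _ + _ _; apply; apply/set_mem/valP. Qed.

Let subL (x y : T) : ldiv (val x) (val y) \in subloop_set S.
Proof. by apply/mem_set; case: (subloopP S) => _ _ + _; apply; apply/set_mem/valP. Qed.

Let subR (x y : T) : rdiv (val x) (val y) \in subloop_set S.
Proof. by apply/mem_set; case: (subloopP S) => _ _ _; apply; apply/set_mem/valP. Qed.

Definition subloop_one : T := exist _ 1 sub1.
Definition subloop_mul (x y : T) : T := exist _ (val x * val y) (subM x y).
Definition subloop_ldiv (x y : T) : T := exist _ (ldiv (val x) (val y)) (subL x y).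
Definition subloop_rdiv (x y : T) : T := exist _ (rdiv (val x) (val y)) (subR x y).

Let mul1x : left_id subloop_one subloop_mul.
Proof. by move=> x; apply: val_inj; rewrite /= mul1g. Qed.

Let mulx1 : right_id subloop_one subloop_mul.
Proof. by move=> x; apply: val_inj; rewrite /= mulg1. Qed.

HB.instance Definition _ := hasMul.Build T subloop_mul.
HB.instance Definition _ := Magma_isUMagma.Build T mul1x mulx1.

Let mul_ldiv (x y : T) : x * subloop_ldiv x y = y.
Proof. by apply: val_inj; rewrite /= mul_ldiv. Qed.

Let ldiv_mul (x y : T) : subloop_ldiv x (x * y) = y.
Proof. by apply: val_inj; rewrite /= ldiv_mul. Qed.

Let rdiv_mul (x y : T) : subloop_rdiv x y * y = x.
Proof. by apply: val_inj; rewrite /= rdiv_mul. Qed.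

Let mul_rdiv (x y : T) : subloop_rdiv (x * y) y = x.
Proof. by apply: val_inj; rewrite /= mul_rdiv. Qed.

HB.instance Definition _ :=
  UMagma_isLoop.Build T mul_ldiv ldiv_mul rdiv_mul mul_rdiv.

End SubloopTheory.

Definition subloop_loop (L : loopType) (S : subloop L) : loopType :=
  subloop_type S.

Definition lcoset_loop (L : loopType) (N : set L) (x : L) : set L :=
  [set x * n | n in N].

Definition rcoset_loop (L : loopType) (N : set L) (x : L) : set L :=
  [set n * x | n in N].

Definition normal_subloop (L : loopType) (N : subloop L) : Prop :=
  forall x y : L,
    [/\ lcoset_loop N x = rcoset_loop N x,
        rcoset_loop (rcoset_loop N x) y = rcoset_loop N (x * y) &
        lcoset_loop (lcoset_loop N x) y = lcoset_loop N (y * x)].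

Definition transversal_loop (L : loopType) (N H : subloop L) : Prop :=
  forall x : L, exists! h : L, subloop_set H h /\ lcoset_loop N x h.

Definition split_extension (L : loopType) (N H : subloop L) : Prop :=
  normal_subloop N /\ transversal_loop N H.

Definition congruence (L : loopType) (R : L -> L -> Prop) : Prop :=
  [/\ forall x, R x x,
      forall x y, R x y -> R y x &
      forall x y z, R x y -> R y z -> R x z] /\
  forall x x' y y', R x x' -> R y y' ->
    [/\ R (x * y) (x' * y'), R (ldiv x y) (ldiv x' y') &
        R (rdiv x y) (rdiv x' y')].

Definition simple_loop (L : loopType) : Prop :=
  (exists x : L, x <> 1) /\
  forall R : L -> L -> Prop, congruence R ->
    (forall x y, R x y -> x = y) \/ (forall x y, R x y).

Definition affine2 (R : pzRingType) (M : lmodType R) (f : M -> M -> M) : Prop :=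
  exists (a b : R) (c : M), forall x y, f x y = (a *: x + b *: y + c)%R.

(* Abelian in the sense of commutator theory. The bijection [phi] turns the
   carrier into a module; the constant operation [1] is affine in any case. *)
Definition abelian_loop (L : loopType) : Prop :=
  exists (R : pzRingType) (M : lmodType R) (phi : L -> M) (psi : M -> L),
    [/\ cancel phi psi /\ cancel psi phi,
        affine2 (fun u v => phi (psi u * psi v)),
        affine2 (fun u v => phi (ldiv (psi u) (psi v))) &
        affine2 (fun u v => phi (rdiv (psi u) (psi v)))].

Definition dprod_type (I : Type) (L : I -> loopType) : Type := forall i, L i.

Section DirectProduct.
Context (I : Type) (L : I -> loopType).
Local Notation T := (dprod_type L).

HB.instance Definition _ := Choice.on T.

Let one : T := fun=> 1.
Let mul (f g : T) : T := fun i => f i * g i.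
Let ldv (f g : T) : T := fun i => ldiv (f i) (g i).
Let rdv (f g : T) : T := fun i => rdiv (f i) (g i).

Let mul1x : left_id one mul.
Proof. by move=> f; apply: functional_extensionality_dep => i; exact: mul1g. Qed.

Let mulx1 : right_id one mul.
Proof. by move=> f; apply: functional_extensionality_dep => i; exact: mulg1. Qed.

HB.instance Definition _ := hasMul.Build T mul.
HB.instance Definition _ := Magma_isUMagma.Build T mul1x mulx1.

Let mul_ldv (f g : T) : f * ldv f g = g.
Proof. by apply: functional_extensionality_dep => i; exact: mul_ldiv. Qed.

Let ldv_mul (f g : T) : ldv f (f * g) = g.
Proof. by apply: functional_extensionality_dep => i; exact: ldiv_mul. Qed.

Let rdv_mul (f g : T) : rdv f g * g = f.
Proof. by apply: functional_extensionality_dep => i; exact: rdiv_mul. Qed.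

Let mul_rdv (f g : T) : rdv (f * g) g = f.
Proof. by apply: functional_extensionality_dep => i; exact: mul_rdiv. Qed.

HB.instance Definition _ :=
  UMagma_isLoop.Build T mul_ldv ldv_mul rdv_mul mul_rdv.

End DirectProduct.

Definition dprod_loop (I : Type) (L : I -> loopType) : loopType := dprod_type L.

Definition power_loop (L : loopType) (X : Type) : loopType :=
  dprod_loop (fun _ : X => L).

Definition variety (P : loopType -> Prop) : Prop :=
  [/\ forall (L M : loopType) (f : L -> M),
        loop_hom f -> set_surj [set: L] [set: M] f -> P L -> P M,
      forall (L : loopType) (S : subloop L), P L -> P (subloop_loop S) &
      forall (I : Type) (L : I -> loopType),
        (forall i, P (L i)) -> P (dprod_loop L)].

Definition variety_generated (K : loopType -> Prop) : loopType -> Prop :=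
  fun L => forall P, variety P -> (forall M, K M -> P M) -> P L.

Definition proper_subloop_of (A : loopType) : loopType -> Prop :=
  fun L => exists2 S : subloop A, subloop_set S <> setT & L = subloop_loop S.

(* [L] is free in [V] over the family [g]; [g] is not required to be injective,
   since it cannot be when [V] only contains trivial loops. *)
Definition free_in (V : loopType -> Prop) (X : Type) (L : loopType)
    (g : X -> L) : Prop :=
  V L /\
  forall (M : loopType), V M -> forall u : X -> M,
    exists! f : L -> M, loop_hom f /\ forall x, f (g x) = u x.

Section Stone.
Context {d : Order.disp_t} (B : ctbDistrLatticeType d).
Implicit Types U V : set B.

Definition proper_filter U : Prop :=
  [/\ U \top%O, ~ U \bot%O,
      forall a b, U a -> U b -> U (a `&` b)%O &
      forall a b, (a <= b)%O -> U a -> U b].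

Definition ultrafilter U : Prop :=
  proper_filter U /\ forall V, proper_filter V -> U `<=` V -> V `<=` U.

Definition stone : Type := {U : set B | ultrafilter U}.

HB.instance Definition _ := gen_eqMixin stone.
HB.instance Definition _ := gen_choiceMixin stone.

Definition stone_basic (b : B) : set stone := [set x | sval x b].

Let stone_cover : \bigcup_(E in range stone_basic) E = setT.
Proof.
apply/seteqP; split=> // x _; exists (stone_basic \top%O); first by exists \top%O.
by have [[xT _ _ _] _] := svalP x.
Qed.

Let stone_join (E F : set stone) (x : stone) :
  range stone_basic E -> range stone_basic F -> E x -> F x ->
  exists G, [/\ range stone_basic G, G x & G `<=` E `&` F].
Proof.
move=> [a _ <-] [b _ <-] xa xb; exists (stone_basic (a `&` b)%O); split.
- by exists (a `&` b)%O.
- by have [[_ _ xI _] _] := svalP x; exact: xI.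
- move=> y yab; have [[_ _ _ yle] _] := svalP y; split.
  + by apply: yle yab; exact: leIl.
  + by apply: yle yab; exact: leIr.
Qed.

HB.instance Definition _ :=
  @isBaseTopological.Build stone (set stone) (range stone_basic) id
    stone_cover stone_join.

Definition atomless : Prop :=
  (\bot%O : B) <> \top%O /\
  forall a : B, (\bot < a)%O -> exists b : B, (\bot < b < a)%O.

End Stone.

Section BooleanPower.
Context (A : loopType) {d : Order.disp_t} (B : ctbDistrLatticeType d).

Local Notation X := (stone B).
Local Notation DA := (discrete_topology A).

Definition boolean_power_set : set (power_loop A X) :=
  [set f | continuous (f : X -> DA)].

Let cstP (f : X -> DA) :
  continuous f <-> forall x, \forall y \near x, f y = f x.
Proof.
split=> cf x.
  have : nbhs (f x : DA) [set f x].
    by rewrite nbhs_principalE; apply/principal_filterP.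
  exact: cf.
move=> U; rewrite nbhs_principalE => /principal_filterP Ufx.
by apply: filterS (cf x) => y /= ->.
Qed.

Let cst2 (op : A -> A -> A) (f g : X -> DA) :
  continuous f -> continuous g ->
  continuous ((fun x => op (f x) (g x)) : X -> DA).
Proof.
move=> /cstP cf /cstP cg; apply/cstP => x.
by apply: filterS2 (cf x) (cg x) => y /= -> ->.
Qed.

Lemma boolean_power_closed : subloop_closed boolean_power_set.
Proof.
split; first by apply/cstP => x; apply: (@filterE X (nbhs x)).
- by move=> f g; exact: cst2.
- by move=> f g; exact: cst2.
- by move=> f g; exact: cst2.
Qed.

Definition boolean_power : subloop (power_loop A X) :=
  Subloop boolean_power_closed.

Definition filtered_boolean_power_set (x : X) :
    set (subloop_loop boolean_power) :=
  [set f | (val f : power_loop A X) x = 1].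

Lemma filtered_boolean_power_closed (x : X) :
  subloop_closed (filtered_boolean_power_set x).
Proof.
split=> [|f g fx gx|f g fx gx|f g fx gx]; first by [].
- by transitivity ((1 : A) * 1); [rewrite -{1}fx -gx | exact: mulg1].
- transitivity (ldiv (1 : A) 1); first by rewrite -{1}fx -gx.
  by rewrite -{2}(mulg1 (1 : A)) ldiv_mul.
- transitivity (rdiv (1 : A) 1); first by rewrite -{1}fx -gx.
  by rewrite -{1}(mulg1 (1 : A)) mul_rdiv.
Qed.

Definition filtered_boolean_power (x : X) : loopType :=
  subloop_loop (Subloop (filtered_boolean_power_closed x)).

End BooleanPower.

(* Main.v *)
Require Import Defs.
From HB Require Import structures.
From mathcomp Require Import all_boot all_order all_algebra.
From mathcomp Require Import all_classical topology.

Set Implicit Arguments.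
Unset Strict Implicit.
Unset Printing Implicit Defensive.

Local Open Scope classical_set_scope.
Local Open Scope group_scope.

(* Fix a sequence [c] generating [C]. Homomorphisms from [C] to [A] are the
   sequences [a] of [A] satisfying the relations of [c]; [N] consists of the
   elements [p(c)] for terms [p] that vanish at all sequences that do not
   generate [A], so that [C / N] is in [W].

   As [A] is simple and its center is trivial, evaluation of terms at
   generating sequences in different orbits of Aut(A) is independent: for every
   [k] there are terms in [k] variables taking a prescribed value at one such
   sequence, and 1 at all sequences outside its orbit. Hence the elements of [N]
   are exactly the functions on a fundamental domain of surjective homomorphisms
   [C -> A] that are locally constant and equal to 1 near infinity, that is, the
   filtered Boolean power over the algebra of clopen sets of its one-point
   compactification.

   Splitting: homomorphisms [C -> A] close to infinity are limits of
   homomorphisms with proper image. Each [a] in the fundamental domain is paired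
   with a homomorphism [shadow a] with proper image that agrees with [a] on as
   many generators as possible below the place where surjectivity of [a] is
   detected, and [H] is the set of [z] with [a(z) = (shadow a)(z)] for all [a].

   For [C] free, all sequences of [A] satisfy the relations, the algebra is
   countable and atomless, and a back-and-forth argument respecting the marked
   ultrafilters identifies it with any other such algebra. *)

(** * Elementary loop arithmetic *)

Section LoopBasics.
Context (L : loopType).
Implicit Types x y z : L.

Lemma mulIl x y z : x * y = x * z -> y = z.
Proof. by move=> /(congr1 (ldiv x)); rewrite !ldiv_mul. Qed.

Lemma ldivE x y z : x * z = y -> ldiv x y = z.
Proof. by move=> <-; rewrite ldiv_mul. Qed.

Lemma rdivE x y z : z * y = x -> rdiv x y = z.
Proof. by move=> <-; rewrite mul_rdiv. Qed.

Lemma ldivxx x : ldiv x x = 1.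
Proof. by apply: ldivE; rewrite mulg1. Qed.

Lemma rdivxx x : rdiv x x = 1.
Proof. by apply: rdivE; rewrite mul1g. Qed.

Lemma ldiv1x x : ldiv 1 x = x.
Proof. by apply: ldivE; rewrite mul1g. Qed.

Lemma rdivx1 x : rdiv x 1 = x.
Proof. by apply: rdivE; rewrite mulg1. Qed.

Lemma rdiv_eq1 x y : rdiv x y = 1 -> x = y.
Proof. by move=> e; rewrite -(rdiv_mul x y) e mul1g. Qed.

End LoopBasics.

(** * The center of a loop and the abelian case *)

Section Central.
Context (A : loopType).
Implicit Types z w x y : A.

Definition central z := forall x y,
  [/\ z * x = x * z, (z * x) * y = z * (x * y) & x * (z * y) = z * (x * y)].

Lemma central1 : central 1.
Proof. by move=> x y; rewrite !mul1g mulg1. Qed.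

Lemma centralM z w : central z -> central w -> central (z * w).
Proof.
move=> cz cw.
have C z' x (c : central z') : z' * x = x * z' by case: (c x 1).
have Al z' x y (c : central z') : (z' * x) * y = z' * (x * y) by case: (c x y).
have Am z' x y (c : central z') : x * (z' * y) = z' * (x * y) by case: (c x y).
move=> x y; split.
- by rewrite (Am z x w cz) (Al z w x cz) (C w x cw).
- by rewrite (Al z w x cz) (Al z (w * x)) // (Al w) // (Al z) //.
- by rewrite (Al z w y cz) (Am z) // (Am w) // (Al z).
Qed.

Lemma centralV z : central z ->
  central (ldiv z 1) /\ forall x, z * (ldiv z 1 * x) = x.
Proof.
move=> cz.
have C x : z * x = x * z by case: (cz x 1).
have Al x y : (z * x) * y = z * (x * y) by case: (cz x y).
have Am x y : x * (z * y) = z * (x * y) by case: (cz x y).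
have V x : z * (ldiv z 1 * x) = x by rewrite -Al mul_ldiv mul1g.
split=> // x y; split; apply: (@mulIl _ z).
- by rewrite V -Am mul_ldiv mulg1.
- by rewrite -Al !V.
- by rewrite -Am !V.
Qed.

Definition central_shift x y := exists2 z, central z & y = z * x.

(** Central factors can be pulled out, [(z x)(w y) = (z w)(x y)], so operations on shifted elements
    give results shifted by a central element. *)
Lemma central_shift_congruence : congruence central_shift.
Proof.
have C z' x (c : central z') : z' * x = x * z' by case: (c x 1).
have Al z' x y (c : central z') : (z' * x) * y = z' * (x * y) by case: (c x y).
have Am z' x y (c : central z') : x * (z' * y) = z' * (x * y) by case: (c x y).
have MM z w x y : central z -> central w ->
    (z * x) * (w * y) = (z * w) * (x * y).
  by move=> cz cw; rewrite !(Al z) // (Am w).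
split; first split.
- by move=> x; exists 1; [exact: central1 | rewrite mul1g].
- move=> x _ [z cz ->]; have [cz' V] := centralV cz.
  by exists (ldiv z 1) => //; rewrite (Am z) // V.
- move=> x _ _ [z cz ->] [w cw ->]; exists (w * z); first exact: centralM.
  by rewrite (Al w).
move=> x _ y _ [z cz ->] [w cw ->].
have [cz' Vz] := centralV cz; have [cw' Vw] := centralV cw.
split.
- by exists (z * w); [exact: centralM | exact: MM].
- exists (ldiv z 1 * w); first exact: centralM.
  apply: ldivE; rewrite MM ?mul_ldiv //; last exact: centralM.
  by rewrite Vz.
- exists (z * ldiv w 1); first exact: centralM.
  apply: rdivE; rewrite MM ?rdiv_mul //; last exact: centralM.
  by rewrite (Al z) // -(C w) // -{1}(mulg1 (ldiv w 1)) Vw mulg1.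
Qed.

End Central.

Section CommutativeGroup.
Context (A : loopType) (cA : forall z : A, central z).

Definition loop_zmod : Type := A.
HB.instance Definition _ := Choice.on loop_zmod.

Let addC : commutative (fun x y : loop_zmod => (x : A) * (y : A)).
Proof. by move=> x y; case: (cA x y 1). Qed.

Let addA : associative (fun x y : loop_zmod => (x : A) * (y : A)).
Proof. by move=> x y z; case: (cA x y z). Qed.

Let add0 : left_id (1 : A) (fun x y : loop_zmod => (x : A) * (y : A)).
Proof. exact: mul1g. Qed.

Let addN : left_inverse (1 : A) (fun x : loop_zmod => rdiv (1 : A) (x : A))
  (fun x y : loop_zmod => (x : A) * (y : A)).
Proof. by move=> x; rewrite rdiv_mul. Qed.

HB.instance Definition _ :=
  GRing.isZmodule.Build loop_zmod addA addC add0 addN.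

Lemma all_central_abelian : abelian_loop A.
Proof.
have mE (x y : A) : x * y = ((x : loop_zmod) + (y : loop_zmod))%R by [].
have lE (x y : A) : ldiv x y = (- (x : loop_zmod) + (y : loop_zmod))%R.
  by apply: ldivE; rewrite mE GRing.addrA GRing.subrr GRing.add0r.
have rE (x y : A) : rdiv x y = ((x : loop_zmod) - (y : loop_zmod))%R.
  by apply: rdivE; rewrite mE -GRing.addrA GRing.addNr GRing.addr0.
exists int, (zmodule loop_zmod : lmodType int), id, id.
split=> //.
- exists 1%R, 1%R, 0%R => x y; rewrite !GRing.scale1r GRing.addr0; exact: mE.
- exists (-1)%R, 1%R, 0%R => x y.
  rewrite GRing.scaleN1r !GRing.scale1r GRing.addr0; exact: lE.
- exists 1%R, (-1)%R, 0%R => x y.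
  rewrite GRing.scaleN1r !GRing.scale1r GRing.addr0; exact: rE.
Qed.

End CommutativeGroup.

(** By simplicity [central_shift] is equality, and then the center is trivial, or total, and then
    every element is central and the loop is an abelian group. *)
Lemma simple_central1 (A : loopType) : simple_loop A -> ~ abelian_loop A ->
  forall z : A, central z -> z = 1.
Proof.
move=> [_ sA] nA z cz.
have [e|tot] := sA _ (central_shift_congruence A).
  by apply/esym/e; exists z => //; rewrite mulg1.
exfalso; apply: nA; apply: all_central_abelian => w.
by have [v cv ->] := tot 1 w; rewrite mulg1.
Qed.

(** * Terms, evaluation and identities *)

Inductive term := Var of nat | One | Mul of term & term
  | Ldv of term & term | Rdv of term & term.

Fixpoint ev (L : loopType) (u : nat -> L) (t : term) : L :=
  match t with
  | Var i => u i
  | One => 1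
  | Mul s t => ev u s * ev u t
  | Ldv s t => ldiv (ev u s) (ev u t)
  | Rdv s t => rdiv (ev u s) (ev u t)
  end.

Fixpoint subst (f : nat -> term) (t : term) : term :=
  match t with
  | Var i => f i
  | One => One
  | Mul s t => Mul (subst f s) (subst f t)
  | Ldv s t => Ldv (subst f s) (subst f t)
  | Rdv s t => Rdv (subst f s) (subst f t)
  end.

(* A strict upper bound for the indices of the variables of a term. *)
Fixpoint bd (t : term) : nat :=
  match t with
  | Var i => i.+1
  | One => 0
  | Mul s t | Ldv s t | Rdv s t => maxn (bd s) (bd t)
  end.

(** Prefixes are padded with 1, so that they remain sequences and generate the same subloop as their
    first [k] entries. *)
Definition trunc (L : loopType) k (u : nat -> L) : nat -> L :=
  fun i => if (i < k)%N then u i else 1.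

Definition tr k := subst (fun i => if (i < k)%N then Var i else One).

Fixpoint term_tree (t : term) : GenTree.tree nat :=
  match t with
  | Var i => GenTree.Leaf i
  | One => GenTree.Node 0 [::]
  | Mul s t => GenTree.Node 1 [:: term_tree s; term_tree t]
  | Ldv s t => GenTree.Node 2 [:: term_tree s; term_tree t]
  | Rdv s t => GenTree.Node 3 [:: term_tree s; term_tree t]
  end.

Fixpoint tree_term (t : GenTree.tree nat) : term :=
  match t with
  | GenTree.Leaf i => Var i
  | GenTree.Node 1 [:: s; t] => Mul (tree_term s) (tree_term t)
  | GenTree.Node 2 [:: s; t] => Ldv (tree_term s) (tree_term t)
  | GenTree.Node 3 [:: s; t] => Rdv (tree_term s) (tree_term t)
  | _ => One
  end.

Lemma term_treeK : cancel term_tree tree_term.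
Proof. by elim=> //= s -> t ->. Qed.

HB.instance Definition _ := Countable.copy term (can_type term_treeK).

Section Evaluation.
Context (L : loopType).
Implicit Types (u v : nat -> L) (s t : term).

Lemma ev_ext u v t : (forall i, (i < bd t)%N -> u i = v i) -> ev u t = ev v t.
Proof.
elim: t => //= [i|s IHs t IHt|s IHs t IHt|s IHs t IHt] e; first exact: e.
all: by rewrite IHs ?IHt // => i it; apply: e; rewrite leq_max it ?orbT.
Qed.

Lemma ev_subst f u t : ev u (subst f t) = ev (fun i => ev u (f i)) t.
Proof. by elim: t => //= s -> t ->. Qed.

Lemma ev_tr k u t : ev u (tr k t) = ev (trunc k u) t.
Proof.
rewrite ev_subst; congr ev; apply: funext => i; rewrite /trunc.
by case: ifP.
Qed.

Lemma ev_trunc k u t : (bd t <= k)%N -> ev (trunc k u) t = ev u t.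
Proof.
by move=> tk; apply: ev_ext => i it; rewrite /trunc (leq_trans it tk).
Qed.

Lemma ev_cst1 t : ev (fun=> 1 : L) t = 1.
Proof. by elim: t => //= s -> t ->; rewrite ?mulg1 ?ldivxx ?rdivxx. Qed.

Lemma trunc_trunc k l u : (k <= l)%N -> trunc k (trunc l u) = trunc k u.
Proof.
move=> kl; apply: funext => i; rewrite /trunc; case: ifP => // ik.
by rewrite (leq_trans ik kl).
Qed.

Lemma trunc_id k u : trunc k (trunc k u) = trunc k u.
Proof. exact: trunc_trunc. Qed.

Lemma truncP k u v : (forall i, (i < k)%N -> u i = v i) <->
  trunc k u = trunc k v.
Proof.
split=> [e|e i ik].
  by apply: funext => i; rewrite /trunc; case: ifP => // /e.
by have := congr1 (@^~ i) e; rewrite /trunc ik.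
Qed.

Lemma truncW k l u v : (k <= l)%N -> trunc l u = trunc l v ->
  trunc k u = trunc k v.
Proof. by move=> kl e; rewrite -(trunc_trunc u kl) e trunc_trunc. Qed.

End Evaluation.

Lemma ev_hom (L M : loopType) (f : L -> M) u t : loop_hom f ->
  f (ev u t) = ev (f \o u) t.
Proof.
move=> [f1 fM fl fr].
by elim: t => //= s IHs t IHt; rewrite ?fM ?fl ?fr IHs IHt.
Qed.

Lemma ev_closed (L : loopType) (S : set L) u t : subloop_closed S ->
  (forall i, S (u i)) -> S (ev u t).
Proof.
by move=> [S1 SM Sl Sr] Su; elim: t => //= s IHs t IHt;
  [exact: SM|exact: Sl|exact: Sr].
Qed.

Definition holds (L : loopType) (s t : term) := forall u : nat -> L,
  ev u s = ev u t.

(** The easy direction of Birkhoff's theorem. *)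
Lemma holds_variety s t : variety (fun L => holds L s t).
Proof.
split.
- move=> L M f fh fs Ls u.
  have /choice[v vu] i : exists x, f x = u i.
    by have [x _ <-] := fs (u i) I; exists x.
  have -> : u = f \o v by apply: funext => i; rewrite /= vu.
  by rewrite -!ev_hom // Ls.
- move=> L S Ls u; apply: val_inj.
  have hv : loop_hom (val : subloop_loop S -> L) by split.
  by rewrite (ev_hom u s hv) (ev_hom u t hv).
- move=> I L Ls u; apply: functional_extensionality_dep => i.
  have hv : loop_hom (fun x : dprod_loop L => x i) by split.
  by rewrite (ev_hom u s hv) (ev_hom u t hv) Ls.
Qed.

(** * Generation and the homomorphism preorder on sequences *)

Definition gen (L : loopType) (a : nat -> L) := forall x, exists t, ev a t = x.

(* [kle y a] says that [y i |-> a i] extends to a homomorphism from the subloop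
   generated by [y]. *)
Definition kle (L M : loopType) (y : nat -> L) (a : nat -> M) :=
  forall s t, ev y s = ev y t -> ev a s = ev a t.

Definition keq (L M : loopType) (y : nat -> L) (a : nat -> M) :=
  kle y a /\ kle a y.

Lemma kle_trans (L M P : loopType) (y : nat -> L) (a : nat -> M)
    (b : nat -> P) :
  kle y a -> kle a b -> kle y b.
Proof. by move=> ya ab s t /ya/ab. Qed.

Lemma kle_trunc (L M : loopType) k (y : nat -> L) (a : nat -> M) :
  kle y a -> kle (trunc k y) (trunc k a).
Proof. by move=> ya s t; rewrite -!ev_tr => /ya. Qed.

Lemma keq_trunc (L M : loopType) k (y : nat -> L) (a : nat -> M) :
  keq y a -> keq (trunc k y) (trunc k a).
Proof. by case=> ya ay; split; exact: kle_trunc. Qed.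

Lemma kle1 (L M : loopType) (y : nat -> L) (a : nat -> M) t :
  kle y a -> ev y t = 1 -> ev a t = 1.
Proof. by move=> ya; exact: (ya t One). Qed.

Lemma gen_truncW (L : loopType) k l (a : nat -> L) : (k <= l)%N ->
  gen (trunc k a) -> gen (trunc l a).
Proof.
move=> kl ga x; have [t <-] := ga x; exists (tr k t).
by rewrite ev_tr trunc_trunc.
Qed.

Lemma gen_trunc_gen (L : loopType) k (a : nat -> L) : gen (trunc k a) -> gen a.
Proof.
by move=> ga x; have [t <-] := ga x; exists (tr k t); rewrite ev_tr.
Qed.

(* Terms that vanish when [r] does or when both [s] and [t] do, and whose
   vanishing for all values of [s] and [t] makes the value of [r] central. *)
Definition obstructions (r s t : term) : seq term :=
  [:: Rdv (Mul r s) (Mul s r);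
      Rdv (Mul (Mul r s) t) (Mul r (Mul s t));
      Rdv (Mul s (Mul r t)) (Mul r (Mul s t))].

Section Obstructions.
Context (L : loopType) (u : nat -> L).

Lemma obstructions_l r s t o : ev u r = 1 -> o \in obstructions r s t ->
  ev u o = 1.
Proof.
move=> r1; rewrite !inE => /or3P[] /eqP -> /=;
  by rewrite r1 ?mul1g ?mulg1 rdivxx.
Qed.

Lemma obstructions_r r s t o : ev u s = 1 -> ev u t = 1 ->
  o \in obstructions r s t -> ev u o = 1.
Proof.
move=> s1 t1; rewrite !inE => /or3P[] /eqP -> /=;
  by rewrite s1 ?t1 ?mul1g ?mulg1 rdivxx.
Qed.

Lemma obstructions_central (Q : set term) r :
  (forall x, exists2 s, Q s & ev u s = x) ->
  (forall s t o, Q s -> Q t -> o \in obstructions r s t -> ev u o = 1) ->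
  central (ev u r).
Proof.
move=> Qs Q1 x y; have [s s1 <-] := Qs x; have [t t1 <-] := Qs y.
split; apply: rdiv_eq1.
- apply: (Q1 s t (Rdv (Mul r s) (Mul s r))) => //.
  by rewrite !inE eqxx.
- apply: (Q1 s t (Rdv (Mul (Mul r s) t) (Mul r (Mul s t)))) => //.
  by rewrite !inE eqxx orbT.
- apply: (Q1 s t (Rdv (Mul s (Mul r t)) (Mul r (Mul s t)))) => //.
  by rewrite !inE eqxx !orbT.
Qed.

End Obstructions.

(** * Sequences in a finite loop *)

Section FiniteLoop.
Context (A : loopType) (Afin : finite_set [set: A]).
Implicit Types (a b w y : nat -> A).

Lemma finite_loop_enum : exists2 e : seq A, uniq e & forall x, x \in e.
Proof.
have [e eA] := (finite_seqP _).1 Afin.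
exists (undup e); first exact: undup_uniq.
move=> x; have : [set: A] x by [].
by rewrite eA /= mem_undup.
Qed.

(** Choosing preimages under the surjection [y i |-> a i] gives an injection of [A] into the subloop
    generated by [y]. As [A] is finite, that subloop is [A] and the surjection is an
    automorphism. *)
Lemma kle_gen y a : gen a -> kle y a -> gen y /\ keq y a.
Proof.
move=> /choice[t ta] ya; have [e ue eA] := finite_loop_enum.
have inj : injective (fun x => ev y (t x)).
  by move=> x x' /ya; rewrite !ta.
have me : [seq ev y (t x) | x <- e] =i e.
  by apply: (uniq_min_size _ _ _).2; rewrite ?size_map ?map_inj_uniq // => x _.
have surj x : exists z, ev y (t z) = x.
  by have := eA x; rewrite -me => /mapP[z _ ->]; exists z.
split; first by move=> x; have [z <-] := surj x; exists (t z).
split=> // p q pq; have [z zp] := surj (ev y p); have [z' zq] := surj (ev y q).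
rewrite -zp -zq; congr (ev y (t _)).
by rewrite -(ta z) (ya _ _ zp) pq -(ya _ _ zq) ta.
Qed.

Lemma trunc_list k : exists l : seq (nat -> A), forall y, trunc k y \in l.
Proof.
have [e _ eA] := finite_loop_enum.
elim: k => [|k [l lP]].
  exists [:: fun=> 1] => y; rewrite inE; apply/eqP/funext => i.
  by rewrite /trunc ltn0.
exists [seq (fun i => if i == k then x else z i) | z <- l, x <- e] => y.
apply/allpairsP; exists (trunc k y, y k); split=> //=.
apply: funext => i; rewrite /trunc ltnS.
by case: eqP => [->|/eqP ik]; rewrite ?leqnn // leq_eqVlt (negbTE ik).
Qed.

Lemma gen_trunc a : gen a -> exists k, gen (trunc k a).
Proof.
move=> /choice[t ta]; have [e _ eA] := finite_loop_enum.
exists (\max_(x <- e) bd (t x)) => x; exists (t x).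
by rewrite ev_trunc // (@leq_bigmax_seq _ e predT (fun x => bd (t x))).
Qed.

(** * Independence of evaluations at different orbits *)

Section Simple.
Context (Asimple : simple_loop A) (Acent : forall z : A, central z -> z = 1).

(** Pairs of values at [a] of terms that agree on [Y] form a congruence of [A]. It is equality or
    total; in the second case, dividing two terms that agree on [Y] gives [p]. *)
Lemma gen_dichotomy a (Y : set (nat -> A)) : gen a ->
  (forall p q, (forall y, Y y -> ev y p = ev y q) -> ev a p = ev a q) \/
  (forall x, exists2 p, ev a p = x & forall y, Y y -> ev y p = 1).
Proof.
move=> ga.
pose R x x' := exists p q,
  [/\ ev a p = x, ev a q = x' & forall y, Y y -> ev y p = ev y q].
have cR : congruence R.
  split; first split.
  - by move=> x; have [p px] := ga x; exists p, p.
  - by move=> x x' [p [q [px qx pq]]]; exists q, p; split=> // y /pq.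
  - move=> _ _ _ [p [q [<- <- pq]]] [p' [q' [pq' <- pq1]]].
    (* Mal'cev argument: [p (q \ p')] has the value of [p] at [a], where [q] and [p'] agree, and
       that of [p'] on [Y], where [p] and [q] agree. *)
    exists (Mul p (Ldv q p')), q'; split=> //= [|y Yy].
      by rewrite pq' ldivxx mulg1.
    by rewrite (pq y) // mul_ldiv pq1.
  move=> _ _ _ _ [p [q [<- <- pq]]] [p' [q' [<- <- pq']]].
  split; [exists (Mul p p'), (Mul q q')|exists (Ldv p p'), (Ldv q q')|
    exists (Rdv p p'), (Rdv q q')]; split=> //= y Yy; by rewrite pq ?pq'.
have [e|tot] := Asimple.2 R cR; [left|right].
  by move=> p q pq; apply: e; exists p, q.
move=> x; have [p [q [px q1 pq]]] := tot x 1.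
exists (Rdv p q) => /= [|y Yy]; first by rewrite px q1 rdivx1.
by rewrite pq // rdivxx.
Qed.

(** Induction on [l]. Take [r] vanishing at the new [z] but not at [a]. Obstructions of [r] with
    terms vanishing on the rest of the list vanish on all of it; if this forced them to vanish at
    [a], the value of [r] there would be central, hence 1. *)
Lemma separate a (l : seq (nat -> A)) : gen a -> forall x, exists2 p,
  ev a p = x & forall y, y \in l -> ~ kle y a -> ev y p = 1.
Proof.
move=> ga; elim: l => [|z l IH] x.
  by have [p px] := ga x; exists p.
have [za|nza] := pselect (kle z a).
  have [p px pl] := IH x; exists p => // y.
  by rewrite inE => /orP[/eqP ->|/pl].
have [r r1 rz] : exists2 r, ev a r <> 1 & ev z r = 1.
  have [det|/(_ x) [p px pz]] := gen_dichotomy [set z] ga.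
    by exfalso; apply: nza => p q pq; apply: det => y ->.
  have [[x0 x1] _] := Asimple.
  have [det|/(_ x0) [p' px' pz']] := gen_dichotomy [set z] ga.
    by exfalso; apply: nza => p' q pq; apply: det => y ->.
  by exists p'; [rewrite px'|exact: pz'].
have [det|/(_ x) [p px pz]] :=
  gen_dichotomy [set y | y \in z :: l /\ ~ kle y a] ga; last first.
  by exists p => // y yl ya; exact: pz.
exfalso; apply: r1; apply: Acent.
apply: (@obstructions_central _ _
  [set s | forall y, y \in l -> ~ kle y a -> ev y s = 1]).
  by move=> x'; have [p px pl] := IH x'; exists p.
move=> s t o /= s1 t1 ost; apply: (det o One) => y [].
rewrite inE => /orP[/eqP -> _|yl ya]; first exact: obstructions_l ost.
by apply: obstructions_r ost; [exact: s1|exact: t1].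
Qed.

(** For generating [w], such a term is concentrated on the orbit of [w] among the [k]-prefixes. *)
Definition atom k w q x :=
  ev w q = x /\ forall y, ~ kle (trunc k y) w -> ev (trunc k y) q = 1.

Lemma atom_ex k w x : gen w -> exists q, atom k w q x.
Proof.
move=> gw; have [l lP] := trunc_list k; have [p px pl] := separate l gw x.
by exists p; split=> // y; exact: pl.
Qed.

(** The term is a product of atoms: at each [w] all factors but its own are 1. [Phi] is a side
    condition inherited by products: vacuous for interpolation, vanishing in [C] for
    faithfulness. *)
Lemma sum_atoms (Phi : set term) k (ws : seq (nat -> A)) (f : (nat -> A) -> A) :
  Phi One -> (forall s t, Phi s -> Phi t -> Phi (Mul s t)) ->
  (forall w, w \in ws -> trunc k w = w) ->
  {in ws &, forall w w', kle w w' -> w = w'} ->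
  (forall w, w \in ws -> exists2 q, Phi q & atom k w q (f w)) ->
  exists2 p, Phi p & (forall w, w \in ws -> ev w p = f w) /\
    forall y, (forall w, w \in ws -> ~ kle (trunc k y) w) ->
      ev (trunc k y) p = 1.
Proof.
move=> Phi1 PhiM; elim: ws => [|w ws IH] trw inj at_.
  by exists One.
have wi : w \in w :: ws by rewrite inE eqxx.
have sub z : z \in ws -> z \in w :: ws by rewrite inE orbC => ->.
have [||z zws|p Phip [pws p1]] := IH.
- by move=> z /sub/trw.
- by move=> z z' /sub zi /sub; exact: inj.
- exact/at_/sub.
have [wws|nwws] := boolP (w \in ws).
  exists p => //; split=> [z|y yw].
    by rewrite inE => /orP[/eqP ->|]; exact: pws.
  by apply: p1 => z /sub; exact: yw.
have [q Phiq [qw q1]] := at_ w wi.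
exists (Mul p q); first exact: PhiM.
split=> [z|y yw] /=.
  rewrite inE => /orP[/eqP ->|zws].
    rewrite qw -(trw w wi) p1 ?mul1g // => v vws; rewrite trw // => wv.
    by move: nwws; rewrite (inj w v) ?vws //; exact: sub.
  rewrite pws // -[in ev z q](trw z) ?sub // q1 ?mulg1 //; last first.
  rewrite trw ?sub // => zw; move: nwws; rewrite -(inj z w) ?zws //.
  exact: sub.
by rewrite p1 ?mul1g => [|z /sub /yw//]; rewrite q1 //; exact: yw.
Qed.

(** * A fundamental domain for Aut(A) on generating sequences *)

Definition lam a : nat :=
  xget 0%N [set k | gen (trunc k a) /\ forall j, gen (trunc j a) -> (k <= j)%N].

Lemma lamP a : gen a ->
  gen (trunc (lam a) a) /\ forall j, gen (trunc j a) -> (lam a <= j)%N.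
Proof.
move=> ga; apply: (@xgetPex _ 0%N [set k | gen (trunc k a) /\
  forall j, gen (trunc j a) -> (k <= j)%N]).
have ex : exists k, `[< gen (trunc k a) >].
  by have [k gk] := gen_trunc ga; exists k; apply/asboolP.
exists (ex_minn ex); case: ex_minnP => k /asboolP gk kmin; split=> // j gj.
by apply: kmin; apply/asboolP.
Qed.

Lemma lam_le k a : gen (trunc k a) -> (lam a <= k)%N.
Proof. by move=> gk; have [_] := lamP (gen_trunc_gen gk); exact. Qed.

Lemma gen_keq a b : keq a b -> gen b -> gen a.
Proof. by move=> [ab _] gb; have [] := kle_gen gb ab. Qed.

Lemma keq_sym a b : keq a b -> keq b a. Proof. by case. Qed.

Lemma lam_eq k a b : gen (trunc k a) -> keq (trunc k a) (trunc k b) ->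
  lam a = lam b.
Proof.
suff H a' b' : gen (trunc k a') -> keq (trunc k a') (trunc k b') ->
    (lam a' <= lam b')%N.
  move=> ga ab; apply/eqP; rewrite eqn_leq H //=; apply: H.
    exact: gen_keq (keq_sym ab) ga.
  exact: keq_sym.
move=> ga ab; have gb := gen_keq (keq_sym ab) ga.
have lb := lam_le gb; have [glb _] := lamP (gen_trunc_gen gb).
apply: lam_le; apply: gen_keq glb.
by have := keq_trunc (lam b') ab; rewrite !trunc_trunc.
Qed.

(** The choice depends only on the set of candidates, so equivalent sequences get the same
    representative; the set contains [w], so the default is never taken. *)
Definition rep w : nat -> A := xget (fun=> 1) [set b | keq w b].

Lemma rep_keq w : keq w (rep w).
Proof. by apply: (@xgetPex _ (fun=> 1) [set b | keq w b]); exists w; split. Qed.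

Lemma keq_trans a b y : keq a b -> keq b y -> keq a y.
Proof.
by move=> [ab ba] [b_y yb]; split;
  [exact: kle_trans ab b_y|exact: kle_trans yb ba].
Qed.

Lemma keq_rep w w' : keq w w' -> rep w = rep w'.
Proof.
move=> ww'; rewrite /rep; congr xget; apply/seteqP; split=> b /= wb.
  exact: keq_trans (keq_sym ww') wb.
exact: keq_trans ww' wb.
Qed.

(* Generating sequences in the class of [a] are the images of [a] under the
   automorphisms of [A]; [fdom] contains one of them, chosen by looking at the
   shortest generating prefix only. *)
Definition fdom a := gen a /\ rep (trunc (lam a) a) = trunc (lam a) a.

(** All entries of [a] are written as terms in its shortest generating prefix and re-evaluated at
    the representative of that prefix, which amounts to applying an automorphism. *)
Lemma fdom_ex a : gen a -> exists2 b, fdom b & keq a b.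
Proof.
move=> ga; have [gk _] := lamP ga; set k := lam a in gk.
have /choice[t ta] i : exists t, ev (trunc k a) t = a i by exact: gk.
pose w := rep (trunc k a); have [aw wa] := rep_keq (trunc k a).
pose b i := ev w (t i).
have aE s : ev a s = ev (trunc k a) (subst t s).
  by rewrite ev_subst; congr ev; apply: funext => i; rewrite ta.
have bE s : ev b s = ev w (subst t s) by rewrite ev_subst.
have ab : keq a b by split=> p q; rewrite !aE !bE; [exact: aw|exact: wa].
have bw : trunc k b = w.
  apply: funext => i; rewrite /trunc; case: ifP => ik.
    rewrite /b; apply: (aw (t i) (Var i)); rewrite ta /=.
    by rewrite /trunc ik.
  by apply/esym/(aw (Var i) One); rewrite /= /trunc ik.
have lb : lam b = k.
  by apply/esym/(@lam_eq k) => //; exact: keq_trunc.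
exists b => //; split; first exact: gen_keq (keq_sym ab) ga.
by rewrite lb bw; apply: keq_rep; exact: keq_sym (rep_keq _).
Qed.

(** The two shortest generating prefixes are equivalent and both are representatives, so they
    coincide. The automorphism relating [a] and [b] then fixes a generating sequence and is the
    identity. *)
Lemma fdom_inj k a b : fdom a -> fdom b -> gen (trunc k b) ->
  kle (trunc k a) (trunc k b) -> trunc k a = trunc k b.
Proof.
move=> [_ ra] [_ rb] gb kab; have [ga ab] := kle_gen gb kab.
have lab := lam_eq ga ab; have lk := lam_le ga.
have [gl _] := lamP (gen_trunc_gen ga).
have ww : trunc (lam a) a = trunc (lam a) b.
  rewrite -ra lab -rb -lab; apply: keq_rep.
  by have := keq_trunc (lam a) ab; rewrite !trunc_trunc.
apply/truncP => i ik; have [s si] := gl (a i).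
rewrite -{1}si ww; apply/esym.
have : ev (trunc k a) (Var i) = ev (trunc k a) (tr (lam a) s).
  by rewrite ev_tr trunc_trunc //= si /trunc ik.
by move=> /kab; rewrite ev_tr trunc_trunc //= /trunc ik.
Qed.

Lemma fdom_trunc k a b : fdom a -> gen (trunc k a) -> trunc k b = trunc k a ->
  fdom b.
Proof.
move=> [ga ra] gk ab; split.
  by apply: (@gen_trunc_gen _ k); rewrite ab.
have lab : lam a = lam b by apply: (@lam_eq k) => //; rewrite ab; split.
rewrite -lab; have -> // : trunc (lam a) b = trunc (lam a) a.
by apply: truncW ab; exact: lam_le.
Qed.

(** Generating [k]-prefixes of members of [fdom] are finitely many and lie in different orbits, so
    atoms at them can be multiplied. *)
Lemma interpolate k (q : (nat -> A) -> A) : exists p,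
  (forall y, ~ gen (trunc k y) -> ev (trunc k y) p = 1) /\
  forall a, fdom a -> gen (trunc k a) -> ev (trunc k a) p = q (trunc k a).
Proof.
have [l lP] := trunc_list k.
pose W w := exists2 a, fdom a /\ gen (trunc k a) & trunc k a = w.
pose ws := [seq w <- l | `[< W w >]].
have wsP w : w \in ws <-> W w.
  rewrite mem_filter; split=> [/andP[/asboolP]//|Ww].
  by apply/andP; split; [apply/asboolP|case: Ww => a _ <-; exact: lP].
have [||||w /wsP [a [_ ga] <-]|p _ [pw p1]] := @sum_atoms setT k ws q.
- by [].
- by [].
- by move=> w /wsP[a _ <-]; rewrite trunc_id.
- move=> _ _ /wsP[a [fa ga] <-] /wsP[b [fb gb] <-]; exact: fdom_inj.
- by have [r rP] := atom_ex k (q (trunc k a)) ga; exists r.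
exists p; split=> [y gy|a fa ga]; last by apply: pw; apply/wsP; exists a.
apply: p1 => w /wsP [a [fa ga] <-] ya; apply: gy.
by have [] := kle_gen ga ya.
Qed.

(* Koenig's lemma. *)
Lemma prefix_limit (w : nat -> nat -> A) : exists a, forall K,
  exists2 l, (K <= l)%N & trunc K (w l) = trunc K a.
Proof.
have [e _ eA] := finite_loop_enum.
pose inf (b : nat -> A) k :=
  forall K, exists2 l, (K <= l)%N & trunc k (w l) = trunc k b.
pose upd (b : nat -> A) k x : nat -> A := fun i => if i == k then x else b i.
have step b k : inf b k -> exists x, inf (upd b k x) k.+1.
  move=> ib; apply: contrapT => /forallNP nx.
  have /choice[K KP] x : exists K, forall l, (K <= l)%N ->
      trunc k.+1 (w l) <> trunc k.+1 (upd b k x).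
    apply: contrapT => /forallNP nK; apply: (nx x) => K.
    apply: contrapT => nl; apply: (nK K) => l Kl e'.
    by apply: nl; exists l.
  (* Pigeonhole: past the maximum of the finitely many bounds, no value is left for entry [k]. *)
  have [l Kl lb] := ib (\max_(x <- e) K x)%N.
  apply: (KP (w l k) l).
    by apply: leq_trans Kl; rewrite (@leq_bigmax_seq _ e predT K).
  apply/truncP => i; rewrite ltnS leq_eqVlt /upd.
  by case: eqP => [->//|_ /=]; move: i; apply/truncP.
have [f fP] : exists f : (nat -> A) -> nat -> A,
    forall b k, inf b k -> inf (upd b k (f b k)) k.+1.
  have /choice[f fP] (bk : (nat -> A) * nat) :
      exists x, inf bk.1 bk.2 -> inf (upd bk.1 bk.2 x) bk.2.+1.
    have [ib|nib] := pselect (inf bk.1 bk.2); last by exists 1.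
    by have [x xP] := step _ _ ib; exists x.
  by exists (fun b k => f (b, k)) => b k; exact: (fP (b, k)).
pose F := fix F k : nat -> A := if k is k'.+1 then upd (F k') k' (f (F k') k')
  else fun=> 1.
have FP k : inf (F k) k.
  elim: k => [K|k IH]; last exact: fP.
  by exists K => //; apply/truncP.
have FS k i : (i < k)%N -> F k i = F i.+1 i.
  elim: k => // k IH; rewrite ltnS leq_eqVlt => /orP[/eqP -> //|ik].
  by rewrite -IH //= /upd ltn_eqF.
(* Entry [i] is set at stage [i.+1] and not changed later. *)
exists (fun i => F i.+1 i) => K; have [l Kl lK] := FP K K; exists l => //.
by rewrite lK; apply/truncP => i iK; exact: FS.
Qed.

(** * Transfer from [A] to a loop satisfying its identities *)

Section Generated.
Context (C : loopType) (c : nat -> C).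
Context (CA : forall s t, holds A s t -> ev c s = ev c t).

(** Agreement at [w] carries over to its whole orbit, so together with agreement off the orbit it
    makes an identity of [A] in [k] variables. *)
Lemma agree_on_trunc k w s t : gen w -> trunc k w = w -> ev w s = ev w t ->
  (forall y, ~ kle (trunc k y) w -> ev (trunc k y) s = ev (trunc k y) t) ->
  ev (trunc k c) s = ev (trunc k c) t.
Proof.
move=> gw trw st off; rewrite -!ev_tr; apply: CA => y; rewrite !ev_tr.
have [yw|nyw] := pselect (kle (trunc k y) w); last exact: off.
by have [_ [_ wy]] := kle_gen gw yw; exact: wy.
Qed.

(** Values of atoms that agree in [C] are related by a congruence of [A]. Were it equality,
    obstructions of [r] with atoms, which vanish in [C], would vanish at [w] and make the value of
    [r] central. So it is total, and some atom with the value of [q] agrees in [C] with one of value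
    1, that is, with 1. *)
Lemma atom_eq1 k w r q x : gen w -> trunc k w = w ->
  ev (trunc k c) r = 1 -> ev w r <> 1 -> atom k w q x -> ev (trunc k c) q = 1.
Proof.
move=> gw trw r1 rw [qx q1].
pose R x x' := exists p q,
  [/\ atom k w p x, atom k w q x' & ev (trunc k c) p = ev (trunc k c) q].
have op (f : term -> term -> term) (g : forall L : loopType, L -> L -> L) :
    (forall (L : loopType) (u : nat -> L) s t,
      ev u (f s t) = g L (ev u s) (ev u t)) ->
    (forall L, g L 1 1 = 1) ->
    forall x1 x1' x2 x2', R x1 x1' -> R x2 x2' -> R (g A x1 x2) (g A x1' x2').
  move=> fg g1 x1 x1' x2 x2' [p [p' [[pw po] [pw' po'] pp]]].
  move=> [s [s' [[sw so] [sw' so'] ss]]].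
  exists (f p s), (f p' s'); rewrite !fg pp ss; split=> //.
    by split=> [|y yw]; rewrite fg ?pw ?sw // po // so.
  by split=> [|y yw]; rewrite fg ?pw' ?sw' // po' // so'.
have cR : congruence R.
  split; first split.
  - by move=> z; have [p pP] := atom_ex k z gw; exists p, p.
  - by move=> z z' [p [p' [pP pP' pp]]]; exists p', p.
  - move=> z1 z2 z3 [p [p' [pP [p2 po] pp]]] [s [s' [[s2 so] sP' ss]]].
    exists p, s'; split=> //; rewrite pp -ss; apply: agree_on_trunc => //.
      by rewrite p2 s2.
    by move=> y yw; rewrite po ?so.
  move=> x1 x1' x2 x2' R1 R2; split.
  - by apply: (op Mul (fun L x z => x * z)) R1 R2 => // L; rewrite mulg1.
  - by apply: (op Ldv (fun L x z => ldiv x z)) R1 R2 => // L; rewrite ldivxx.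
  - by apply: (op Rdv (fun L x z => rdiv x z)) R1 R2 => // L; rewrite rdivxx.
have [e|tot] := Asimple.2 R cR; last first.
  have [p [p' [[p1 po] [p1' po'] pp]]] := tot x 1.
  transitivity (ev (trunc k c) p).
    by apply: agree_on_trunc => //; [rewrite qx p1|move=> y yw; rewrite q1 ?po].
  by rewrite pp; apply: (@agree_on_trunc k w p' One).
exfalso; apply: rw; apply: Acent.
apply: (@obstructions_central _ _ [set s | exists z, atom k w s z]).
  by move=> z; have [p pP] := atom_ex k z gw; exists p; [exists z|case: pP].
move=> s t o [zs [_ so]] [zt [_ to]] ost; apply: e; exists o, One; split=> //.
  split=> // y yw; apply: (obstructions_r _ _ ost); [exact: so|exact: to].
exact: obstructions_l ost.
Qed.

(* Were [p] not to vanish in [C], then for all [l] it would not vanish at some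
   homomorphism to [A] from the subloop generated by the first [l] generators;
   these homomorphisms have a limit point in [Hom(C, A)]. *)
Lemma faithful p : (forall a, ~ gen a -> ev a p = 1) ->
  (forall a, fdom a -> kle c a -> ev a p = 1) -> ev c p = 1.
Proof.
move=> png pS; apply: contrapT => pc.
have /choice[w wP] l : exists w, (bd p <= l)%N ->
    ev w p <> 1 /\ kle (trunc l c) w.
  have [pl|] := leqP (bd p) l; last by exists (fun=> 1).
  (* Otherwise, at each generating [l]-prefix from [fdom], [p] is 1 or a relation of [C] fails;
     either way the atom with the value of [p] there vanishes in [C]. The product [q] of these atoms
     agrees with [p] on all [l]-prefixes, so [p] vanishes in [C] too. *)
  apply: contrapT => /forallNP nw; apply: pc.
  have [ts tsP] := trunc_list l.
  pose W w := exists2 a, fdom a /\ gen (trunc l a) & trunc l a = w.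
  pose ws := [seq w <- ts | `[< W w >]].
  have wsP w : w \in ws <-> W w.
    rewrite mem_filter; split=> [/andP[/asboolP]//|Ww].
    by apply/andP; split; [apply/asboolP|case: Ww => a _ <-; exact: tsP].
  have [||||_ /wsP[a [fa ga] <-]|q qc [qw q1]] :=
    @sum_atoms [set q | ev (trunc l c) q = 1] l ws (fun w => ev w p).
  - by [].
  - by move=> s t /= -> ->; rewrite mulg1.
  - by move=> w /wsP[a _ <-]; rewrite trunc_id.
  - move=> _ _ /wsP[a [fa ga] <-] /wsP[b [fb gb] <-]; exact: fdom_inj.
  - have [q qP] := atom_ex l (ev (trunc l a) p) ga.
    exists q => //=; have [p1|p1] := pselect (ev (trunc l a) p = 1).
      apply: (@agree_on_trunc l (trunc l a) q One) => //.
      + by rewrite trunc_id.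
      + by case: qP => -> _.
      + by case: qP.
    have [r r1 rw] : exists2 r, ev (trunc l c) r = 1 & ev (trunc l a) r <> 1.
      apply: contrapT => nr; apply: (nw (trunc l a)) => _; split=> // s t st.
      apply: rdiv_eq1; apply: contrapT => rst; apply: nr.
      by exists (Rdv s t) => //=; rewrite st rdivxx.
    by apply: atom_eq1 r1 rw qP => //; rewrite trunc_id.
  rewrite -(ev_trunc _ pl) -(qc : _ = 1) -!ev_tr; apply: CA => y.
  rewrite !ev_tr.
  have [gy|ngy] := pselect (gen (trunc l y)); last first.
    rewrite png // q1 // => _ /wsP[a [fa ga] <-] ya; apply: ngy.
    by have [] := kle_gen ga ya.
  have [b fb yb] := fdom_ex gy.
  have yb' := keq_trunc l yb; rewrite trunc_id in yb'.
  have gb : gen (trunc l b) by exact: gen_keq (keq_sym yb') gy.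
  by apply: yb'.2; apply/esym; apply: qw; apply/wsP; exists b.
have [a aP] := prefix_limit w.
have apr t : exists2 l, (bd t <= l)%N &
    forall s, (bd s <= bd t)%N -> ev (w l) s = ev a s.
  have [l tl la] := aP (bd t); exists l => // s st.
  by rewrite -(ev_trunc (w l) st) la ev_trunc.
have pa : ev a p <> 1.
  have [l pl lE] := apr p; rewrite -lE //.
  by have [] := wP l pl.
have ca : kle c a.
  (* The product serves only to bound the variables of [p], [s] and [t] at once. *)
  move=> s t st; have [l] := apr (Mul p (Mul s t)).
  rewrite /= !geq_max => /andP[pl /andP[sl tl]] lE.
  rewrite -!lE ?leq_max ?leqnn ?orbT //.
  by have [_] := wP l pl; apply; rewrite !ev_trunc.
have [ga|nga] := pselect (gen a); last by apply: pa; exact: png.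
have [b fb ab] := fdom_ex ga.
by apply: pa; apply: (kle1 ab.2); apply: pS => //; exact: kle_trans ca ab.1.
Qed.

End Generated.
End Simple.
End FiniteLoop.

Lemma subloop_val (L : loopType) (S : subloop L) (z : subloop_loop S) :
  subloop_set S (val z).
Proof. exact: set_mem (valP (z : subloop_type S)). Qed.

Definition in_subloop (L : loopType) (S : subloop L) (z : L)
    (Sz : subloop_set S z) : subloop_loop S :=
  exist (fun z => z \in subloop_set S) z (mem_set Sz).

(** * The normal subloop and its complement *)

Section Splitting.
Context (A : loopType) (Afin : finite_set [set: A]).
Context (Asimple : simple_loop A) (Acent : forall z : A, central z -> z = 1).
Context (C : loopType) (c : nat -> C) (cgen : gen c).
Context (CA : forall s t, holds A s t -> ev c s = ev c t).
Implicit Types (a b w : nat -> A) (z : C).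

Definition tm z : term := sval (cid (cgen z)).

Lemma tmK z : ev c (tm z) = z.
Proof. by rewrite /tm; case: cid. Qed.

(* The value at [z] of the homomorphism [C -> A] that maps [c i] to [a i]. *)
Definition vl z a : A := ev a (tm z).

Lemma vlE t a : kle c a -> vl (ev c t) a = ev a t.
Proof. by move=> ca; apply: ca; rewrite tmK. Qed.

Lemma vlM z z' a : kle c a -> vl (z * z') a = vl z a * vl z' a.
Proof. by move=> ca; have := vlE (Mul (tm z) (tm z')) ca; rewrite /= !tmK. Qed.

Lemma vlL z z' a : kle c a -> vl (ldiv z z') a = ldiv (vl z a) (vl z' a).
Proof. by move=> ca; have := vlE (Ldv (tm z) (tm z')) ca; rewrite /= !tmK. Qed.

Lemma vlR z z' a : kle c a -> vl (rdiv z z') a = rdiv (vl z a) (vl z' a).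
Proof. by move=> ca; have := vlE (Rdv (tm z) (tm z')) ca; rewrite /= !tmK. Qed.

Lemma vl1 a : kle c a -> vl 1 a = 1.
Proof. by move=> ca; exact: (vlE One ca). Qed.

(** Equivalently, [p = 1] is an identity of all proper subloops of [A]; [radical_set] is thus the
    verbal subloop belonging to [W]. *)
Definition vanishing (p : term) := forall a, ~ gen a -> ev a p = 1.

Definition radical_set : set C := [set z | exists2 p, vanishing p & ev c p = z].

Lemma radical_closed : subloop_closed radical_set.
Proof.
split; first by exists One.
- move=> _ _ [p p1 <-] [q q1 <-]; exists (Mul p q) => // a ga.
  by rewrite /= p1 ?q1 ?mulg1.
- move=> _ _ [p p1 <-] [q q1 <-]; exists (Ldv p q) => // a ga.
  by rewrite /= p1 ?q1 ?ldivxx.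
- move=> _ _ [p p1 <-] [q q1 <-]; exists (Rdv p q) => // a ga.
  by rewrite /= p1 ?q1 ?rdivxx.
Qed.

Definition radical : subloop C := Subloop radical_closed.

Lemma radical_ev p : vanishing p -> radical_set (ev c p).
Proof. by move=> p1; exists p. Qed.

(** In each inclusion, solving for the required element by division gives a term in [s], [t] and [p]
    that is 1 whenever [p] is. *)
Lemma radical_normal : normal_subloop radical.
Proof.
move=> x y; rewrite -(tmK x) -(tmK y); move: (tm x) (tm y) => s t.
split; apply/seteqP; split.
- move=> _ [_ [p p1 <-] <-].
  exists (ev c (Rdv (Mul s p) s)); last by rewrite /= rdiv_mul.
  by apply: radical_ev => a ga /=; rewrite p1 // mulg1 rdivxx.
- move=> _ [_ [p p1 <-] <-].
  exists (ev c (Ldv s (Mul p s))); last by rewrite /= mul_ldiv.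
  by apply: radical_ev => a ga /=; rewrite p1 // mul1g ldivxx.
- move=> _ [_ [_ [p p1 <-] <-] <-].
  exists (ev c (Rdv (Mul (Mul p s) t) (Mul s t))); last by rewrite /= rdiv_mul.
  by apply: radical_ev => a ga /=; rewrite p1 // mul1g rdivxx.
- move=> _ [_ [p p1 <-] <-].
  exists (ev c (Rdv (Mul p (Mul s t)) t)); last by rewrite /= rdiv_mul.
  exists (ev c (Rdv (Rdv (Mul p (Mul s t)) t) s)); last by rewrite /= rdiv_mul.
  by apply: radical_ev => a ga /=; rewrite p1 // mul1g mul_rdiv rdivxx.
- move=> _ [_ [_ [p p1 <-] <-] <-].
  exists (ev c (Ldv (Mul t s) (Mul t (Mul s p)))); last by rewrite /= mul_ldiv.
  by apply: radical_ev => a ga /=; rewrite p1 // mulg1 ldivxx.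
- move=> _ [_ [p p1 <-] <-].
  exists (ev c (Ldv t (Mul (Mul t s) p))); last by rewrite /= mul_ldiv.
  exists (ev c (Ldv s (Ldv t (Mul (Mul t s) p)))); last by rewrite /= mul_ldiv.
  by apply: radical_ev => a ga /=; rewrite p1 // mulg1 ldiv_mul ldivxx.
Qed.

Lemma nongen1 : ~ gen (fun=> 1 : A).
Proof.
have [[x x1] _] := Asimple.
by move=> /(_ x) [t tx]; apply: x1; rewrite -tx ev_cst1.
Qed.

Definition extends_nongen a l :=
  exists b, [/\ kle c b, ~ gen b & trunc l b = trunc l a].

Lemma extends_nongen0 a : extends_nongen a 0.
Proof.
exists (fun=> 1); split.
- by move=> s t _; rewrite !ev_cst1.
- exact: nongen1.
- by apply/truncP.
Qed.

(** Compactness: a limit of counterexamples for growing [K] satisfies the relations of [C] and does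
    not generate, since both are decided on prefixes, and it agrees up to [l] with one of the
    counterexamples. *)
Lemma extends_nongen_far l : exists K, forall a, kle c a ->
  ~ gen (trunc K a) -> extends_nongen a l.
Proof.
apply: contrapT => /forallNP nK.
have /choice[f fP] K : exists a,
    [/\ kle c a, ~ gen (trunc K a) & ~ extends_nongen a l].
  apply: contrapT => /forallNP na; apply: (nK K) => a ca ga.
  by apply: contrapT => ne; apply: (na a).
have [b bP] := prefix_limit Afin f.
have [k lk kb] := bP l; have [_ _] := fP k; apply; exists b; split.
- move=> s t st; have [j jst jb] := bP (maxn (bd s) (bd t)).
  have [cj _ _] := fP j.
  have := cj _ _ st.
  rewrite -(ev_trunc (f j) (leq_maxl _ (bd t))) jb ev_trunc ?leq_maxl //.
  rewrite -(ev_trunc (f j) (leq_maxr (bd s) _)) jb ev_trunc ?leq_maxr //.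
- move=> /(gen_trunc Afin)[m gm]; have [j mj jb] := bP m.
  have [_ + _] := fP j; apply; apply: (gen_truncW mj); by rewrite jb.
- by rewrite kb.
Qed.

(* A homomorphism [C -> A] with a nongenerating image that agrees with [w] on
   the longest possible initial segment below [lam w]. *)
Definition psi w : nat -> A := xget (fun=> 1) [set b | [/\ kle c b, ~ gen b &
  exists2 l, trunc l b = trunc l w &
    forall l', (l' <= lam w)%N -> extends_nongen w l' -> (l' <= l)%N]].

Lemma psiP w : [/\ kle c (psi w), ~ gen (psi w) &
  exists2 l, trunc l (psi w) = trunc l w &
    forall l', (l' <= lam w)%N -> extends_nongen w l' -> (l' <= l)%N].
Proof.
apply: (@xgetPex _ (fun=> 1) [set b | [/\ kle c b, ~ gen b &
  exists2 l, trunc l b = trunc l w &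
    forall l', (l' <= lam w)%N -> extends_nongen w l' -> (l' <= l)%N]]).
pose P l := (l <= lam w)%N && `[< extends_nongen w l >].
have ex : exists l, P l by exists 0%N; apply/asboolP; exact: extends_nongen0.
have ub l : P l -> (l <= lam w)%N by case/andP.
have [l /andP[_ /asboolP[b [cb gb bw]]] lmax] := ex_maxnP ex ub.
exists b; split=> //; exists l => // l' l'w el'; apply: lmax.
by rewrite /P l'w; apply/asboolP.
Qed.

(** Only the shortest generating prefix enters, so that interpolation on prefixes can refer to
    shadows. *)
Definition shadow a := psi (trunc (lam a) a).

Lemma kle_shadow a : kle c (shadow a).
Proof. by rewrite /shadow; case: (psiP (trunc (lam a) a)). Qed.

Lemma shadow_nongen a : ~ gen (shadow a).
Proof. by rewrite /shadow; case: (psiP (trunc (lam a) a)). Qed.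

Lemma lam_trunc k a : gen (trunc k a) -> lam (trunc k a) = lam a.
Proof.
move=> gk; apply: (lam_eq Afin (k := k)); first by rewrite trunc_id.
by rewrite trunc_id; split.
Qed.

Lemma shadow_trunc k a : gen (trunc k a) -> shadow (trunc k a) = shadow a.
Proof.
move=> gk; rewrite /shadow lam_trunc // trunc_trunc //.
exact: (lam_le Afin).
Qed.

(** Here [lam a] exceeds [l] and the [l]-prefix extends to a nongenerating homomorphism, so the
    longest agreement chosen by [psi] reaches [l]. *)
Lemma shadow_far l : exists2 K, (l <= K)%N & forall a, gen a -> kle c a ->
  ~ gen (trunc K a) -> trunc l (shadow a) = trunc l a.
Proof.
have [K KP] := extends_nongen_far l; exists (maxn l K); first exact: leq_maxl.
move=> a ga ca gK; have [gl _] := lamP Afin ga.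
have Kl : (maxn l K < lam a)%N.
  by rewrite ltnNge; apply/negP => le; exact/gK/(gen_truncW le).
have la : (l <= lam a)%N.
  by apply: ltnW; apply: leq_ltn_trans Kl; exact: leq_maxl.
have [b [cb gb ba]] : extends_nongen a l.
  by apply: KP => // gK'; apply: gK; apply: gen_truncW gK'; exact: leq_maxr.
rewrite /shadow; have [_ _ [j ja jmax]] := psiP (trunc (lam a) a).
have lj : (l <= j)%N.
  apply: jmax; first by rewrite lam_trunc.
  by exists b; split=> //; rewrite trunc_trunc.
by rewrite (truncW lj ja) trunc_trunc.
Qed.

Definition complement_set : set C :=
  [set z | forall a, fdom a -> kle c a -> vl z a = vl z (shadow a)].

Lemma complement_closed : subloop_closed complement_set.
Proof.
split.
- by move=> a _ ca; rewrite !vl1 //; exact: kle_shadow.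
- move=> x y Hx Hy a fa ca.
  by rewrite !vlM ?(Hx a fa ca) ?(Hy a fa ca) //; exact: kle_shadow.
- move=> x y Hx Hy a fa ca.
  by rewrite !vlL ?(Hx a fa ca) ?(Hy a fa ca) //; exact: kle_shadow.
- move=> x y Hx Hy a fa ca.
  by rewrite !vlR ?(Hx a fa ca) ?(Hy a fa ca) //; exact: kle_shadow.
Qed.

Definition complement : subloop C := Subloop complement_closed.

Lemma radical_shadow z a : radical_set z -> vl z (shadow a) = 1.
Proof.
move=> [p p1 <-]; rewrite vlE; last exact: kle_shadow.
exact/p1/shadow_nongen.
Qed.

(** Elements of the radical are 1 at shadows; those also in the complement are therefore 1 on
    [fdom], and [faithful] applies. *)
Lemma radical_complement z : radical_set z -> complement_set z -> z = 1.
Proof.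
move=> Nz Hz; have [p p1 pz] := Nz; rewrite -pz.
apply: (faithful Afin Asimple Acent CA) => // a fa ca.
by rewrite -(vlE _ ca) pz Hz // radical_shadow.
Qed.

(** For [z = t(c)], [n] interpolates [t(a) / t(shadow a)], so that [n \ z] takes the value
    [t(shadow a)] at [a]. Where the [m]-prefix does not generate, [n] is 1 and [a] agrees with its
    shadow on the variables of [t]. *)
Lemma radical_decomposition z :
  exists2 n, radical_set n & complement_set (ldiv n z).
Proof.
rewrite -(tmK z); move: (tm z) => t.
have [m tm_ mP] := shadow_far (bd t).
have [p [p1 pq]] := interpolate Afin Asimple Acent m
  (fun w => rdiv (ev w t) (ev (shadow w) t)).
have Np : radical_set (ev c (tr m p)).
  apply: radical_ev => a ga; rewrite ev_tr; apply: p1.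
  by move=> /gen_trunc_gen.
exists (ev c (tr m p)) => // a fa ca; rewrite !vlL //; last exact: kle_shadow.
rewrite radical_shadow // ldiv1x !vlE // ?ev_tr; last exact: kle_shadow.
have [gm|ngm] := pselect (gen (trunc m a)).
  rewrite pq // shadow_trunc // ev_trunc //.
  by apply: ldivE; rewrite rdiv_mul.
rewrite p1 // ldiv1x -(ev_trunc a (leqnn (bd t))).
by rewrite -mP ?ev_trunc //; case: fa.
Qed.

Lemma radical_transversal : transversal_loop radical complement.
Proof.
move=> z; have [n [p p1 pn] Hn] := radical_decomposition z.
exists (ldiv n z); split.
  split=> //; exists (ldiv z (ldiv n z)); last by rewrite mul_ldiv.
  rewrite -pn -(tmK z); apply: (@radical_ev (Ldv (tm z) (Ldv p (tm z)))).
  by move=> a ga /=; rewrite p1 // ldiv1x ldivxx.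
move=> h [Hh [_ [q q1 <-] zq]]; apply: rdiv_eq1; apply: radical_complement.
  rewrite -zq -pn -(tmK z).
  apply: (@radical_ev (Rdv (Ldv p (tm z)) (Mul (tm z) q))) => a ga /=.
  by rewrite p1 // q1 // ldiv1x mulg1 rdivxx.
by have [_ _ _] := complement_closed; apply.
Qed.

End Splitting.

(* [H] is a quotient of a subloop of the product of the subloops of [A]
   generated by the nongenerating sequences. *)
Lemma variety_proper_subloops (A M : loopType) (H : subloop M) (c : nat -> M) :
  gen c ->
  (forall p, @vanishing A p -> subloop_set H (ev c p) -> ev c p = 1) ->
  variety_generated (proper_subloop_of A) (subloop_loop H).
Proof.
move=> cgen HN P [PH PS PP] PA.
pose Z := {a : nat -> A | ~ gen a}.
have span_closed (a : nat -> A) : subloop_closed [set x | exists t, ev a t = x].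
  split; first by exists One.
  - by move=> _ _ [s <-] [t <-]; exists (Mul s t).
  - by move=> _ _ [s <-] [t <-]; exists (Ldv s t).
  - by move=> _ _ [s <-] [t <-]; exists (Rdv s t).
pose span a := Subloop (span_closed a).
pose D := dprod_loop (fun a : Z => subloop_loop (span (sval a))).
have PD : P D.
  apply: PP => -[a na]; apply: PA; exists (span a) => //= e.
  by apply: na => x; have : [set: A] x by []; rewrite -e.
pose Q (f : D) t := forall a, val (f a) = ev (sval a) t.
have K_closed : subloop_closed
    [set f : D | exists2 t, Q f t & subloop_set H (ev c t)].
  have [H1 HM HL HR] := subloopP H.
  split; first by exists One.
  - move=> f g [s fs Hs] [t gt_ Ht]; exists (Mul s t); last exact: HM.
    by move=> a; rewrite /= -fs -gt_.
  - move=> f g [s fs Hs] [t gt_ Ht]; exists (Ldv s t); last exact: HL.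
    by move=> a; rewrite /= -fs -gt_.
  - move=> f g [s fs Hs] [t gt_ Ht]; exists (Rdv s t); last exact: HR.
    by move=> a; rewrite /= -fs -gt_.
pose K := Subloop K_closed.
(* The map [f |-> t(c)] is well defined: the quotient of two terms describing [f] vanishes at all
   nongenerating sequences. *)
have Qeq f s t : Q f s -> Q f t -> subloop_set H (ev c s) ->
    subloop_set H (ev c t) -> ev c s = ev c t.
  move=> fs ft Hs Ht; apply: rdiv_eq1; apply: (HN (Rdv s t)).
    by move=> a na /=; rewrite -(fs (exist _ a na)) -(ft (exist _ a na)) rdivxx.
  by have [_ _ _] := subloopP H; apply.
have /choice[r rP] (f : subloop_loop K) :
    exists z : subloop_loop H, exists2 t, Q (val f) t & val z = ev c t.
  have [t ft Ht] := subloop_val f.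
  by exists (in_subloop Ht); exists t.
have Hr (z : subloop_loop H) : subloop_set H (val z) := subloop_val z.
have rE (f : subloop_loop K) t : Q (val f) t -> subloop_set H (ev c t) ->
    val (r f) = ev c t.
  move=> ft Ht; have [s fs zs] := rP f; rewrite zs; apply: Qeq fs ft _ Ht.
  by rewrite -zs; exact: Hr.
have [H1 HM HL HR] := subloopP H.
apply: (PH (subloop_loop K) _ r); last exact: PS.
  split.
  - by apply: val_inj; rewrite (rE _ One).
  - move=> f g; apply: val_inj => /=.
    have [s fs zs] := rP f; have [t gt_ zt] := rP g.
    rewrite (rE _ (Mul s t)) /=; first by rewrite zs zt.
      by move=> a; rewrite /= -fs -gt_.
    by rewrite -zs -zt; apply: HM; exact: Hr.
  - move=> f g; apply: val_inj => /=.
    have [s fs zs] := rP f; have [t gt_ zt] := rP g.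
    rewrite (rE _ (Ldv s t)) /=; first by rewrite zs zt.
      by move=> a; rewrite /= -fs -gt_.
    by rewrite -zs -zt; apply: HL; exact: Hr.
  - move=> f g; apply: val_inj => /=.
    have [s fs zs] := rP f; have [t gt_ zt] := rP g.
    rewrite (rE _ (Rdv s t)) /=; first by rewrite zs zt.
      by move=> a; rewrite /= -fs -gt_.
    by rewrite -zs -zt; apply: HR; exact: Hr.
move=> z _; have [t tz] := cgen (val z).
have Ht : subloop_set H (ev c t) by rewrite tz; exact: Hr.
pose f : D := fun a => exist _ (ev (sval a) t) (mem_set (ex_intro _ t erefl)).
have fK : subloop_set K f by exists t.
exists (in_subloop (S := K) fK) => //; apply: val_inj.
by rewrite (rE _ t).
Qed.

(** * Ultrafilters and Stone representation *)

Section Ultrafilters.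
Import Order.Theory.
Context {d : Order.disp_t} (B : ctbDistrLatticeType d).
Implicit Types (a b : B) (U V : set B).

Lemma le_meetC a b : (a `&` ~` b = \bot)%O -> (a <= b)%O.
Proof.
by move=> ab; rewrite -[b]complK -disj_leC ab.
Qed.

Lemma ultrafilter_compl U b : ultrafilter U -> U b \/ U (~` b)%O.
Proof.
move=> [[UT U0 UI Ule] Umax]; have [Ub|nUb] := pselect (U b); [by left|right].
pose V := [set c | exists2 u, U u & (u `&` ~` b <= c)%O].
apply: (Umax V); last by exists \top%O; rewrite ?meet1x.
  split.
  - by exists \top%O; rewrite ?lex1.
  - move=> [u Uu]; rewrite lex0 => /eqP /le_meetC ub.
    exact: nUb (Ule _ _ ub Uu).
  - move=> x y [u Uu ux] [v Uv vy]; exists (u `&` v)%O; first exact: UI.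
    rewrite lexI; apply/andP; split.
      by apply: le_trans ux; rewrite leI2 // leIl.
    by apply: le_trans vy; rewrite leI2 // leIr.
  - by move=> x y xy [u Uu ux]; exists u => //; exact: le_trans ux xy.
by move=> u Uu; exists u => //; exact: leIl.
Qed.

Lemma ultrafilter_complF U b : ultrafilter U -> U b -> U (~` b)%O -> False.
Proof.
by move=> [[_ U0 UI _] _] Ub Unb; apply: U0; rewrite -(meetxC b); exact: UI.
Qed.

Lemma ultrafilter_joins (I : eqType) (r : seq I) (F : I -> B) U :
  ultrafilter U -> U (\join_(i <- r) F i)%O -> exists2 i, i \in r & U (F i).
Proof.
move=> uU; have [[_ U0 UI Ule] _] := uU.
elim: r => [|i r IH]; first by rewrite big_nil.
rewrite big_cons => Uj; have [Ui|Uni] := ultrafilter_compl (F i) uU.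
  by exists i; rewrite ?inE ?eqxx.
have [|j jr Uj'] := IH; last by exists j; rewrite ?inE ?jr ?orbT.
apply: Ule (UI _ _ Uj Uni); rewrite meetUl meetxC join0x; exact: leIl.
Qed.

Lemma proper_filter_ultrafilter V : proper_filter V ->
  exists u : stone B, V `<=` sval u.
Proof.
move=> fV; have [VT V0 VI Vle] := fV.
(* Adjoining [V] to each set makes the empty chain, with empty union, admissible. *)
have [F Fsub Ftot|A [fA Amax]] :=
  @Zorn_bigcup _ [set X | proper_filter (V `|` X)].
  split.
  - by left.
  - case=> // -[X FX X0]; have [_ + _ _] := Fsub _ FX; apply; by right.
  - have step X a b : F X -> (V `|` X) a -> (V `|` X) b ->
        (V `|` \bigcup_(X in F) X) (a `&` b)%O.
      move=> FX Xa Xb; have [_ _ XI _] := Fsub _ FX.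
      by have [|Xab] := XI a b Xa Xb; [left|right; exists X].
    move=> a b [Va|[X FX Xa]] [Vb|[Y FY Yb]].
    + by left; exact: VI.
    + by apply: (step Y); [|left|right].
    + by apply: (step X); [|right|left].
    + have [XY|YX] := Ftot X Y FX FY.
        by apply: (step Y) => //; right=> //; exact: XY.
      by apply: (step X) => //; right=> //; exact: YX.
  - move=> a b ab [Va|[X FX Xa]]; first by left; exact: Vle Va.
    have [_ _ _ Xle] := Fsub _ FX.
    by have [|Xb] := Xle a b ab (or_intror Xa); [left|right; exists X].
suff uA : ultrafilter (V `|` A) by exists (exist _ _ uA) => // a Va; left.
split=> // W fW AW a Wa; apply: contrapT => nAa.
apply: (Amax W); last first.
  rewrite /=; have -> // : V `|` W = W.
  by apply/setUidPr => x Vx; apply: AW; left.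
by split=> [x Ax|]; [apply: AW; right|move=> /(_ _ Wa) Aa; apply: nAa; right].
Qed.

Lemma stone_nonzero b : b <> \bot%O -> exists u : stone B, sval u b.
Proof.
move=> b0; have [|u bu] := @proper_filter_ultrafilter [set c | (b <= c)%O].
  split=> /=; first exact: lex1.
  - by rewrite lex0 => /eqP.
  - by move=> x y bx by_; rewrite lexI bx by_.
  - by move=> x y xy bx; exact: le_trans bx xy.
by exists u; exact: bu (lexx b).
Qed.

Lemma stone_ext a b : (forall u : stone B, sval u a <-> sval u b) -> a = b.
Proof.
suff H x y : (forall u : stone B, sval u x -> sval u y) -> (x <= y)%O.
  by move=> ab; apply: le_anti; rewrite !H // => u /ab.
move=> xy; apply: le_meetC; apply: contrapT => /stone_nonzero[u uxy].
have [[_ _ _ ule] _] := svalP u.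
apply: (ultrafilter_complF (b := y) (svalP u)).
  by apply: xy; apply: ule uxy; exact: leIl.
by apply: ule uxy; exact: leIr.
Qed.

Lemma stone_basic_open b : open (stone_basic b).
Proof.
exists [set stone_basic b]; first by move=> _ ->; exists b.
by rewrite bigcup_set1.
Qed.

Lemma stone_openP (O : set (stone B)) u : open O -> O u ->
  exists2 b, sval u b & stone_basic b `<=` O.
Proof.
move=> [D Db <-] [E DE Eu]; have [b _ bE] := Db _ DE.
exists b; first by move: Eu; rewrite -bE.
by move=> v; rewrite bE => Ev; exists E.
Qed.

(** Compactness: an ultrafilter containing the complements of all basic sets inside [O] or inside
    its complement would lie in neither. So some [b1] below [O] and [b2] below its complement join
    to the top, and [b1] is the element sought. *)
Lemma stone_clopen (O : set (stone B)) : open O -> open (~` O) ->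
  exists b, O = stone_basic b.
Proof.
move=> oO oC.
pose V := [set c : B | exists b1 b2, [/\ stone_basic b1 `<=` O,
  stone_basic b2 `<=` ~` O & (~` (b1 `|` b2) <= c)%O]].
have basicU a b (Q : set (stone B)) : stone_basic a `<=` Q ->
    stone_basic b `<=` Q -> stone_basic (a `|` b)%O `<=` Q.
  move=> aQ bQ u uab; have [ua|una] := ultrafilter_compl a (svalP u).
    exact: aQ.
  apply: bQ; have [[_ _ uI ule] _] := svalP u.
  apply: ule (uI _ _ uab una).
  rewrite meetUl meetxC join0x; exact: leIl.
have basic0 (Q : set (stone B)) : stone_basic \bot%O `<=` Q.
  by move=> u; have [[_ u0 _ _] _] := svalP u.
have [V0|nV0] := pselect (V \bot%O).
  have [b1 [b2 [b1O b2O]]] := V0; rewrite lex0 => /eqP b12.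
  exists b1; apply/seteqP; split=> // u Ou.
  have := svalP u; move=> uu; have [[uT _ _ _] _] := uu.
  have [//|una] := ultrafilter_compl b1 uu.
  have [ub|unb] := ultrafilter_compl b2 uu; first by case: (b2O _ ub).
  exfalso; have [[_ u0 uI _] _] := uu; apply: u0; rewrite -b12 complU.
  exact: uI.
exfalso; have [|u Vu] := @proper_filter_ultrafilter V.
  split=> //.
  - by exists \bot%O, \bot%O; rewrite lex1.
  - move=> x y [a1 [a2 [a1O a2O ax]]] [b1 [b2 [b1O b2O b_y]]].
    exists (a1 `|` b1)%O, (a2 `|` b2)%O; split; [exact: basicU|exact: basicU|].
    by rewrite joinACA complU; exact: leI2.
  - move=> x y xy [a1 [a2 [a1O a2O ax]]]; exists a1, a2; split=> //.
    exact: le_trans ax xy.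
have [Ou|nOu] := pselect (O u).
  have [b ub bO] := stone_openP oO Ou.
  apply: (ultrafilter_complF (svalP u) ub); apply: Vu; exists b, \bot%O.
  by split=> //; rewrite joinx0.
have [b ub bO] := stone_openP oC nOu.
apply: (ultrafilter_complF (svalP u) ub); apply: Vu; exists \bot%O, b.
by split=> //; rewrite join0x.
Qed.

End Ultrafilters.

Lemma inj_surj_bijective (S T : Type) (f : S -> T) : injective f ->
  (forall y, exists x, f x = y) -> bijective f.
Proof.
move=> fi /choice[g fg]; exists g => // x; apply: fi; exact: fg.
Qed.

(** * Recognizing filtered Boolean powers by partitions of unity *)

Section FilteredBooleanPowerIso.
Import Order.Theory.
Context (A : loopType) (e : seq A) (eA : forall v, v \in e).
Context {d : Order.disp_t} (B : ctbDistrLatticeType d) (x : stone B).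
Context (N : loopType) (mu : N -> A -> B).

(* [mu n v] is the set of points at which [n] takes the value [v]. *)
Context (mu_disj : forall n v w, v <> w -> (mu n v `&` mu n w = \bot)%O).
Context (mu_cover : forall n, (\join_(v <- e) mu n v = \top)%O).
Context (muM : forall n m v w,
  (mu n v `&` mu m w <= mu (n * m)%g (v * w)%g)%O).
Context (muL : forall n m v w,
  (mu n v `&` mu m w <= mu (ldiv n m) (ldiv v w))%O).
Context (muR : forall n m v w,
  (mu n v `&` mu m w <= mu (rdiv n m) (rdiv v w))%O).
Context (mu_pt : forall n, sval x (mu n 1)).
Context (mu_inj : forall n m, mu n = mu m -> n = m).
Context (mu_surj : forall P : A -> B,
  (forall v w, v <> w -> (P v `&` P w = \bot)%O) ->
  (\join_(v <- e) P v = \top)%O -> sval x (P 1) ->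
  exists n, mu n = P).

Definition stone_fun (n : N) : power_loop A (stone B) :=
  fun u => xget 1 [set v | sval u (mu n v)].

Let ufP (u : stone B) : proper_filter (sval u).
Proof. by have [] := svalP u. Qed.

Let sfP n (u : stone B) v : stone_fun n u = v <-> sval u (mu n v).
Proof.
have [uT u0 uI _] := ufP u.
have sf : sval u (mu n (stone_fun n u)).
  apply: (@xgetPex _ 1 [set v | sval u (mu n v)]).
  have [w _ uw] := ultrafilter_joins (r := e) (F := mu n) (svalP u)
    ltac:(by rewrite mu_cover).
  by exists w.
split=> [<- //|uv]; apply: contrapT => ne; apply: u0.
by rewrite -(mu_disj n ne); exact: uI.
Qed.

Let sf_cont n : boolean_power_set (stone_fun n).
Proof.
move=> u O; rewrite nbhs_principalE => /principal_filterP Ou.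
have : nbhs u (stone_basic (mu n (stone_fun n u))).
  by apply: open_nbhs_nbhs; split; [exact: stone_basic_open|exact/sfP].
by apply: filterS => v /sfP /= ->.
Qed.

Let bp n : subloop_loop (boolean_power A B) :=
  in_subloop (S := boolean_power A B) (@sf_cont n).

Let bp_pt n : filtered_boolean_power_set x (bp n).
Proof. exact/sfP. Qed.

(** Injectivity is [stone_ext]; surjectivity holds because level sets of continuous functions are
    clopen, hence elements of [B]. *)
Lemma filtered_boolean_power_iso :
  loop_isomorphic N (filtered_boolean_power A x).
Proof.
pose f n : filtered_boolean_power A x :=
  in_subloop (S := Subloop (filtered_boolean_power_closed A x)) (@bp_pt n).
exists f.
  have op2 (g : N -> N -> N) (h : A -> A -> A) n m u :
      (forall v w, (mu n v `&` mu m w <= mu (g n m) (h v w))%O) ->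
      stone_fun (g n m) u = h (stone_fun n u) (stone_fun m u).
    move=> gh; apply/sfP; have [_ _ uI ule] := ufP u.
    by apply: ule (gh _ _) _; apply: uI; exact/sfP.
  split.
  - have id1 v : (1 : N) = v -> v * v = v by move=> <-; rewrite mulg1.
    apply: val_inj; apply: val_inj; apply: funext => u /=.
    (* The value of [stone_fun 1] at [u] is idempotent, hence 1 by cancellation. *)
    have := op2 (fun n m => n * m) (fun v w => v * w) 1 1 u (@muM 1 1).
    by rewrite mulg1 -{1}[stone_fun 1 u]mulg1 => /mulIl <-.
  - move=> n m; apply: val_inj; apply: val_inj; apply: funext => u /=.
    exact: (op2 (fun n m => n * m) (fun v w => v * w)).
  - move=> n m; apply: val_inj; apply: val_inj; apply: funext => u /=.
    exact: (op2 (fun n m => ldiv n m) (fun v w => ldiv v w)).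
  - move=> n m; apply: val_inj; apply: val_inj; apply: funext => u /=.
    exact: (op2 (fun n m => rdiv n m) (fun v w => rdiv v w)).
apply: inj_surj_bijective => [n m fnm|g].
  apply: mu_inj; apply: funext => v; apply: stone_ext => u.
  have : stone_fun n = stone_fun m := congr1 (fun z => val (val z)) fnm.
  by split=> /sfP <-; apply/sfP; rewrite H.
pose h : stone B -> discrete_topology A := val (val g).
have hc : continuous h := subloop_val (val g).
have hx : h x = 1 := subloop_val g.
have op v : open (h @^-1` [set v]).
  by apply: open_comp => [u _|]; [exact: hc|exact: discrete_open].
have opC v : open (~` (h @^-1` [set v])).
  rewrite preimage_setC.
  by apply: open_comp => [u _|]; [exact: hc|exact: discrete_open].
have /choice[P PP] v : exists b, h @^-1` [set v] = stone_basic b.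
  by apply: stone_clopen.
have hP u v : h u = v <-> sval u (P v).
  by split=> [huv|uP]; [change (stone_basic (P v) u); rewrite -PP|
    have : stone_basic (P v) u by []; rewrite -PP].
have [||/=|n nP] := mu_surj (P := P).
- move=> v w vw; apply: contrapT => /stone_nonzero[u uvw]; apply: vw.
  have [_ _ _ ule] := ufP u.
  have /hP <- : sval u (P v) by apply: ule uvw; exact: leIl.
  by apply/hP; apply: ule uvw; exact: leIr.
- apply: stone_ext => u; have [uT _ _ ule] := ufP u; split=> // _.
  by apply: ule (_ : sval u (P (h u))); [exact: joins_sup_seq|exact/hP].
- exact/hP.
exists n; apply: val_inj; apply: val_inj; apply: funext => u /=.
by apply/sfP; rewrite nP; exact/hP.
Qed.

End FilteredBooleanPowerIso.

(** * Back and forth between pointed atomless algebras *)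

Section StoneBoolean.
Import Order.Theory.
Context {d : Order.disp_t} (B : ctbDistrLatticeType d) (u : stone B).
Implicit Types a b : B.

Lemma stone_meet a b : sval u (a `&` b)%O = (sval u a /\ sval u b).
Proof.
have [[_ _ uI ule] _] := svalP u.
apply/propext; split=> [uab|[]]; last exact: uI.
by split; apply: ule uab; [exact: leIl|exact: leIr].
Qed.

Lemma stone_compl a : sval u (~` a)%O = ~ sval u a.
Proof.
apply/propext; split=> [ua u'a|nua].
  exact: ultrafilter_complF (svalP u) u'a ua.
by have [] := ultrafilter_compl a (svalP u).
Qed.

Lemma stone_join a b : sval u (a `|` b)%O = (sval u a \/ sval u b).
Proof.
rewrite -[(a `|` b)%O]complK complU stone_compl stone_meet !stone_compl.
by apply/propext; rewrite not_andP !notK.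
Qed.

Lemma stone_bot : sval u \bot%O = False.
Proof. by apply/propext; split=> //; have [[]] := svalP u. Qed.

Lemma stone_top : sval u \top%O = True.
Proof. by apply/propext; split=> // _; have [[]] := svalP u. Qed.

End StoneBoolean.

(** With [stone_ext], these turn Boolean identities into propositional tautologies. *)
Definition stoneE :=
  (@stone_meet, @stone_compl, @stone_join, @stone_bot, @stone_top).

Section BackAndForthInvariant.
Import Order.Theory.
Context {d d' : Order.disp_t} (B : ctbDistrLatticeType d)
  (B' : ctbDistrLatticeType d') (x : stone B) (x' : stone B').

Definition matching (m : B) (m' : B') :=
  (m = \bot%O <-> m' = \bot%O) /\ (sval x m <-> sval x' m').

(* The Boolean combinations of the first components of [l] below [m] match the
   corresponding combinations of the second components below [m']. *)
Fixpoint partial_iso (l : seq (B * B')) (m : B) (m' : B') : Prop :=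
  match l with
  | [::] => matching m m'
  | (b, b') :: l => partial_iso l (m `&` b)%O (m' `&` b')%O /\
                    partial_iso l (m `&` ~` b)%O (m' `&` ~` b')%O
  end.

Lemma partial_iso_bot l : partial_iso l \bot%O \bot%O.
Proof.
elim: l => [|[b b'] l IH] /=; first by rewrite /matching !stoneE.
by rewrite !meet0x.
Qed.

Lemma meet_compl_bot {d0 : Order.disp_t} (D : ctbDistrLatticeType d0)
    (m b : D) :
  m = \bot%O <-> (m `&` b = \bot /\ m `&` ~` b = \bot)%O.
Proof.
split=> [->|[m1 m2]]; first by rewrite !meet0x.
by rewrite -[m]meetx1 -(joinxC b) meetUr m1 m2 joinxx.
Qed.

Lemma stone_split {d0 : Order.disp_t} (D : ctbDistrLatticeType d0) (u : stone D)
  (m b : D) : sval u m <-> (sval u (m `&` b)%O \/ sval u (m `&` ~` b)%O).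
Proof. by rewrite !stoneE; have := EM (sval u b); tauto. Qed.

Lemma partial_iso_matching l m m' : partial_iso l m m' -> matching m m'.
Proof.
elim: l m m' => [|[b b'] l IH] m m' //= [/IH[e1 u1] /IH[e2 u2]].
split; first by rewrite (meet_compl_bot m b) (meet_compl_bot m' b'); tauto.
by rewrite (stone_split x m b) (stone_split x' m' b'); tauto.
Qed.

Lemma partial_iso_meet l m m' b b' : partial_iso l m m' -> (b, b') \in l ->
  partial_iso l (m `&` b)%O (m' `&` b')%O /\
  partial_iso l (m `&` ~` b)%O (m' `&` ~` b')%O.
Proof.
elim: l m m' => [|[b0 b0'] l IH] m m' //= [h1 h2].
rewrite inE => /orP[/eqP[-> ->]|bl].
  by rewrite -!meetA !meetxC !meetCx !meetxx !meetx0; split; split=> //;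
    exact: partial_iso_bot.
have [? ?] := IH _ _ h1 bl; have [? ?] := IH _ _ h2 bl.
by rewrite !(meetAC m b) !(meetAC m' b') !(meetAC m (~` b)%O)
  !(meetAC m' (~` b')%O).
Qed.

Lemma le_meet_compl {d0 : Order.disp_t} (D : ctbDistrLatticeType d0)
    (m b : D) :
  (m <= b)%O <-> (m `&` ~` b = \bot)%O.
Proof.
by split=> [|/le_meetC//]; rewrite -{1}[b]complK -disj_leC => /eqP.
Qed.

Lemma partial_iso_le l b b' c c' : partial_iso l \top%O \top%O ->
  (b, b') \in l -> (c, c') \in l -> ((b <= c)%O <-> (b' <= c')%O).
Proof.
move=> g bl cl; have [gb _] := partial_iso_meet g bl.
have [_ gbc] := partial_iso_meet gb cl.
have [e _] := partial_iso_matching gbc; move: e; rewrite !meet1x => e.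
by rewrite !le_meet_compl.
Qed.

Lemma partial_iso_pt l b b' : partial_iso l \top%O \top%O -> (b, b') \in l ->
  (sval x b <-> sval x' b').
Proof.
move=> g bl; have [gb _] := partial_iso_meet g bl.
by have [_] := partial_iso_matching gb; rewrite !meet1x.
Qed.

(** If [b] cuts [m] properly, atomlessness gives some [c] cutting [m']; either [c] or its complement
    lies on the right side of the marked ultrafilter. *)
Lemma matching_split m m' b : atomless B' -> matching m m' ->
  exists b', matching (m `&` b)%O (m' `&` b')%O /\
             matching (m `&` ~` b)%O (m' `&` ~` b')%O.
Proof.
move=> [_ atB'] mm; have [m0 mx] := mm.
have [mb0|mb0] := pselect (m `&` b = \bot)%O.
  exists \bot%O; rewrite mb0 meetx0 compl0 meetx1; split.
    by rewrite /matching !stoneE.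
  have -> // : (m `&` ~` b)%O = m.
  by apply: le_anti; rewrite leIl lexI lexx -disj_leC mb0 eqxx.
have [mb1|mb1] := pselect (m `&` ~` b = \bot)%O.
  exists \top%O; rewrite mb1 meetx1 compl1 meetx0; split.
    have -> // : (m `&` b)%O = m.
    by apply: le_anti; rewrite leIl lexI lexx le_meetC.
  by rewrite /matching !stoneE.
have m'0 : m' <> \bot%O by move=> /m0 e; apply: mb0; rewrite e meet0x.
have [c /andP[c0 cm]] : exists c, (\bot < c < m')%O.
  by apply: atB'; rewrite lt0x; apply/eqP.
have mc : (m' `&` c <> \bot)%O.
  rewrite (meet_idPr (ltW cm)) => e; by rewrite e ltxx in c0.
have mnc : (m' `&` ~` c <> \bot)%O.
  by move=> /le_meetC mc'; have := le_lt_trans mc' cm; rewrite ltxx.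
have [b' [n1 n2 xb]] : exists b' : B', [/\ (m' `&` b' <> \bot)%O,
    (m' `&` ~` b' <> \bot)%O & (sval x b <-> sval x' b')].
  have [e|ne] := pselect (sval x b <-> sval x' c); first by exists c.
  exists (~` c)%O; rewrite complK; split=> //; rewrite stoneE.
  by have := EM (sval x b); have := EM (sval x' c); tauto.
by exists b'; split; split; rewrite ?stoneE; tauto.
Qed.

(** Partners are found separately inside and outside [b0] and glued along [b0']. *)
Lemma partial_iso_extend l m m' b : atomless B' -> partial_iso l m m' ->
  exists b', partial_iso ((b, b') :: l) m m'.
Proof.
move=> at'; elim: l m m' => [|[b0 b0'] l IH] m m' /=.
  exact: matching_split.
move=> [/IH [b1 [h1 h2]] /IH [b2 [h3 h4]]].
exists ((b0' `&` b1) `|` (~` b0' `&` b2))%O.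
have e1 : (m' `&` (b0' `&` b1 `|` ~` b0' `&` b2) `&` b0' = m' `&` b0' `&` b1)%O.
  by apply: stone_ext => u; rewrite !stoneE; tauto.
have e2 : (m' `&` (b0' `&` b1 `|` ~` b0' `&` b2) `&` ~` b0' =
    m' `&` ~` b0' `&` b2)%O.
  by apply: stone_ext => u; rewrite !stoneE; tauto.
have e3 : (m' `&` ~` (b0' `&` b1 `|` ~` b0' `&` b2) `&` b0' =
    m' `&` b0' `&` ~` b1)%O.
  by apply: stone_ext => u; rewrite !stoneE; tauto.
have e4 : (m' `&` ~` (b0' `&` b1 `|` ~` b0' `&` b2) `&` ~` b0' =
    m' `&` ~` b0' `&` ~` b2)%O.
  by apply: stone_ext => u; rewrite !stoneE; have := EM (sval u b0'); tauto.
by rewrite e1 e2 e3 e4 !(meetAC m b) !(meetAC m (~` b)%O).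
Qed.

End BackAndForthInvariant.

Lemma partial_iso_swap {d d' : Order.disp_t} (B : ctbDistrLatticeType d)
    (B' : ctbDistrLatticeType d') (x : stone B) (x' : stone B') l m m' :
  partial_iso x x' l m m' ->
  partial_iso x' x [seq (p.2, p.1) | p <- l] m' m.
Proof.
elim: l m m' => [|[b b'] l IH] m m' /=; first by rewrite /matching; tauto.
by case=> /IH ? /IH.
Qed.

Section BackAndForth.
Import Order.Theory.
Context {d d' : Order.disp_t} (B : ctbDistrLatticeType d)
  (B' : ctbDistrLatticeType d') (x : stone B) (x' : stone B').
Context (atB : atomless B) (atB' : atomless B').
Context (eB : nat -> B) (eBP : forall b, exists n, eB n = b).
Context (eB' : nat -> B') (eB'P : forall b, exists n, eB' n = b).

Lemma pointed_boolean_iso : exists beta : B -> B',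
  [/\ forall b c, ((beta b <= beta c) = (b <= c))%O,
      forall b', exists b, beta b = b' &
      forall b, sval x b <-> sval x' (beta b)].
Proof.
pose ok l := partial_iso x x' l \top%O \top%O.
(* One round finds a partner for [eB n] and then, with the algebras exchanged, one for [eB' n]. *)
have /choice[f fP] (nl : nat * seq (B * B')) : exists l', ok nl.2 ->
    [/\ ok l', exists b', (eB nl.1, b') \in l', exists b, (b, eB' nl.1) \in l' &
        {subset nl.2 <= l'}].
  case: nl => n l /=; have [okl|nok] := pselect (ok l); last by exists [::].
  have [b' okb'] := partial_iso_extend (eB n) atB' okl.
  have [b okb] := partial_iso_extend (eB' n) atB (partial_iso_swap okb').
  exists ((b, eB' n) :: (eB n, b') :: l) => _; split.
  - have := partial_iso_swap okb; rewrite /= -map_comp.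
    by rewrite (eq_map (g := id)) ?map_id // => -[].
  - by exists b'; rewrite !inE eqxx orbT.
  - by exists b; rewrite !inE eqxx.
  - by move=> p pl; rewrite !inE pl !orbT.
pose L := fix L n := if n is n'.+1 then f (n', L n') else [::].
have okL n : ok (L n).
  elim: n => [|n IH]; last by have [] := fP (n, L n) IH.
  split; rewrite ?stoneE //.
  by split=> e; [case: atB|case: atB'] => + _; rewrite e.
have Lmono m n : (m <= n)%N -> {subset L m <= L n}.
  move=> /subnK <-; elim: (n - m)%N => // k IH p /IH pL.
  by have [_ _ _] := fP (k + m, L (k + m)%N) (okL _); apply.
pose Rel b b' := exists n, (b, b') \in L n.
have RelP b b' c c' : Rel b b' -> Rel c c' -> ((b <= c)%O <-> (b' <= c')%O).
  move=> [n bn] [m cm]; apply: (partial_iso_le (okL (maxn n m))).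
    by apply: Lmono bn; exact: leq_maxl.
  by apply: Lmono cm; exact: leq_maxr.
have /choice[beta betaP] b : exists b', Rel b b'.
  have [n <-] := eBP b; have [_ [b' bb'] _ _] := fP (n, L n) (okL n).
  by exists b', n.+1.
exists beta; split.
- by move=> b c; apply/idP/idP; apply (RelP _ _ _ _ (betaP b) (betaP c)).
- move=> b'; have [n nb'] := eB'P b'.
  have [_ _ [b bb'] _] := fP (n, L n) (okL n); rewrite nb' in bb'.
  have Rb : Rel b b' by exists n.+1.
  exists b; apply: le_anti; apply/andP; split.
    by apply (RelP _ _ _ _ (betaP b) Rb).
  by apply (RelP _ _ _ _ Rb (betaP b)).
- by move=> b; have [n bn] := betaP b; exact: partial_iso_pt (okL n) bn.
Qed.

End BackAndForth.

(** * The algebra of sets decided at a finite level *)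

Section KeyAlgebra.
Context (X K : Type) (key : nat -> X -> K).

Definition key_monotone := forall k l p q, (k <= l)%N ->
  key l p = key l q -> key k p = key k q.

Context (key_mono : key_monotone).

Definition key_invariant (U : set X) :=
  exists k, forall p q, key k p = key k q -> U p -> U q.

(** Monotonicity is an argument of the type because closure under meets relies on it. *)
Definition key_algebra of key_monotone : Type :=
  {U : set X | `[< key_invariant U >]}.
Local Notation T := (key_algebra key_mono).
HB.instance Definition _ := Choice.on T.

Definition in_key_algebra U (iU : key_invariant U) : T :=
  exist (fun U => `[< key_invariant U >]) U (asboolT iU).

Lemma key_algebraP (U : T) : key_invariant (val U).
Proof. exact/asboolP/(valP U). Qed.

Lemma key_invariantI U V : key_invariant U -> key_invariant V ->
  key_invariant (U `&` V).
Proof.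
move=> [k kU] [l lV]; exists (maxn k l) => p q pq [Up Vp].
split; [apply: kU Up|apply: lV Vp]; apply: key_mono pq;
  [exact: leq_maxl|exact: leq_maxr].
Qed.

Lemma key_invariantC U : key_invariant U -> key_invariant (~` U).
Proof. by move=> [k kU]; exists k => p q pq nU /(kU q p (esym pq)). Qed.

Lemma key_invariantU U V : key_invariant U -> key_invariant V ->
  key_invariant (U `|` V).
Proof.
move=> iU iV; rewrite -[U `|` V]setCK setCU.
by apply/key_invariantC/key_invariantI; exact: key_invariantC.
Qed.

Lemma key_invariant0 : key_invariant set0.
Proof. by exists 0%N. Qed.

Lemma key_invariantT : key_invariant setT.
Proof. by exists 0%N. Qed.

Let meet (U V : T) :=
  in_key_algebra (key_invariantI (key_algebraP U) (key_algebraP V)).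
Let join (U V : T) :=
  in_key_algebra (key_invariantU (key_algebraP U) (key_algebraP V)).
Let compl (U : T) :=
  in_key_algebra (key_invariantC (key_algebraP U)).
Let le (U V : T) := `[< val U `<=` val V >].
Let lt (U V : T) := (V != U) && le U V.

Let le_def U V : le U V = (meet U V == U).
Proof.
apply/asboolP/eqP => [UV|<-]; last exact: subIsetr.
by apply: val_inj; apply/setIidPl.
Qed.
Let lt_def U V : lt U V = (V != U) && le U V. Proof. by []. Qed.
Let meetC : commutative meet.
Proof. by move=> U V; apply: val_inj; exact: setIC. Qed.
Let joinC : commutative join.
Proof. by move=> U V; apply: val_inj; exact: setUC. Qed.
Let meetA : associative meet.
Proof. by move=> U V W; apply: val_inj; exact: setIA. Qed.
Let joinA : associative join.
Proof. by move=> U V W; apply: val_inj; exact: setUA. Qed.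
Let joinKI V U : meet U (join U V) = U.
Proof. by apply: val_inj; rewrite /= setUC setKU. Qed.
Let meetKU V U : join U (meet U V) = U.
Proof. by apply: val_inj; rewrite /= setIC setKI. Qed.
Let meetUl : left_distributive meet join.
Proof. by move=> U V W; apply: val_inj; exact: setIUl. Qed.
Let meetxx : idempotent_op meet.
Proof. by move=> U; apply: val_inj; exact: setIid. Qed.

HB.instance Definition _ :=
  Order.isMeetJoinDistrLattice.Build set_display T
    le_def lt_def meetC joinC meetA joinA joinKI meetKU meetUl meetxx.

Lemma key_leP (U V : T) : reflect (val U `<=` val V) (U <= V)%O.
Proof. exact: asboolP. Qed.

Let le0 (U : T) : (in_key_algebra key_invariant0 <= U)%O.
Proof. by apply/key_leP => p []. Qed.
Let le1 (U : T) : (U <= in_key_algebra key_invariantT)%O.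
Proof. by apply/key_leP. Qed.

HB.instance Definition _ := Order.hasBottom.Build set_display T le0.
HB.instance Definition _ := Order.hasTop.Build set_display T le1.

Let joinxC (U : T) : (U `|` compl U = \top)%O.
Proof. by apply: val_inj; exact: setUCr. Qed.
Let meetxC (U : T) : (U `&` compl U = \bot)%O.
Proof. by apply: val_inj; exact: setICr. Qed.

HB.instance Definition _ :=
  Order.TBDistrLattice_hasComplement.Build set_display T joinxC meetxC.

Lemma principal_ultrafilter p : ultrafilter [set U : T | val U p].
Proof.
split.
  split=> [|[]|U V Up Vp|U V /key_leP UV Up]; [by []|by split|exact: UV].
move=> V [VT V0 VI Vle] pV U VU; apply: contrapT => nUp; apply: V0.
rewrite -(Order.CTBDistrLatticeTheory.meetxC U); apply: VI => //.
exact: (pV (compl U)).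
Qed.

Definition principal p : stone T := exist _ _ (principal_ultrafilter p).

End KeyAlgebra.

Lemma countable_enum (T : Type) (t0 : T) : countable [set: T] ->
  exists f : nat -> T, forall t, exists n, f n = t.
Proof.
move=> /countable_injP[f fi].
have /choice[g gP] n : exists t, (exists t', f t' = n) -> f t = n.
  by have [[t tn]|nt] := pselect (exists t', f t' = n); [exists t|exists t0].
exists g => t; exists (f t); apply: fi; rewrite ?in_setT //.
by apply: gP; exists t.
Qed.

(** * The radical as a filtered Boolean power *)

Section RadicalBooleanPower.
Import Order.Theory.
Context (A : loopType) (Afin : finite_set [set: A]).
Context (Asimple : simple_loop A) (Acent : forall z : A, central z -> z = 1).
Context (C : loopType) (c : nat -> C) (cgen : gen c).
Context (CA : forall s t, holds A s t -> ev c s = ev c t).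

Definition hom_point : Type := {a : nat -> A | fdom a /\ kle c a}.

(* The base point [None] is where all elements of the radical take the value 1;
   the homomorphisms whose restriction to the first [k] generators is not
   surjective cannot be distinguished from it at level [k]. *)
Definition hom_key k (p : option hom_point) : option (nat -> A) :=
  if p is Some a then
    if pselect (gen (trunc k (sval a))) then Some (trunc k (sval a)) else None
  else None.

Lemma hom_keyT k (a : hom_point) : gen (trunc k (sval a)) ->
  hom_key k (Some a) = Some (trunc k (sval a)).
Proof. by rewrite /hom_key; case: pselect. Qed.

Lemma hom_keyF k (a : hom_point) : ~ gen (trunc k (sval a)) ->
  hom_key k (Some a) = None.
Proof. by rewrite /hom_key; case: pselect. Qed.

Lemma hom_key_mono : key_monotone hom_key.
Proof.
move=> k l p q kl.
suff E r : hom_key k r = if hom_key l r is Some w then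
    if pselect (gen (trunc k w)) then Some (trunc k w) else None else None.
  by rewrite !E => ->.
case: r => //= a; case: (pselect (gen (trunc l (sval a)))) => [gl|ngl] /=.
  by rewrite trunc_trunc.
by case: pselect => /= [gk|//]; case: ngl; exact: gen_truncW gk.
Qed.

Definition hom_algebra : ctbDistrLatticeType set_display :=
  key_algebra hom_key_mono.

Definition value (z : C) (p : option hom_point) : A :=
  if p is Some a then vl cgen z (sval a) else 1.

Lemma valueM y z p : value (y * z) p = value y p * value z p.
Proof. by case: p => [[a [fa ca]]|] /=; rewrite ?mulg1 // vlM. Qed.

Lemma valueL y z p : value (ldiv y z) p = ldiv (value y p) (value z p).
Proof. by case: p => [[a [fa ca]]|] /=; rewrite ?ldivxx // vlL. Qed.

Lemma valueR y z p : value (rdiv y z) p = rdiv (value y p) (value z p).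
Proof. by case: p => [[a [fa ca]]|] /=; rewrite ?rdivxx // vlR. Qed.

Lemma radical_value_inj y z : radical_set A c y -> radical_set A c z ->
  value y = value z -> y = z.
Proof.
move=> Ny Nz yz; apply: rdiv_eq1.
have [_ _ _ NR] := radical_closed A c; have [p p1 pE] := NR _ _ Ny Nz.
rewrite -pE; apply: (faithful Afin Asimple Acent CA) => // a fa ca.
rewrite -(vlE cgen _ ca) pE.
have := valueR y z (Some (exist _ a (conj fa ca))).
by rewrite yz rdivxx.
Qed.

(** At level [bd t] the prefix determines the value of [t]; if it does not generate, [t] vanishes,
    as at the base point. *)
Lemma radical_value_key z : radical_set A c z ->
  exists k, forall p q, hom_key k p = hom_key k q -> value z p = value z q.
Proof.
move=> [t t1 <-]; exists (bd t).
suff E p : value (ev c t) p = if hom_key (bd t) p is Some w then ev w t else 1.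
  by move=> p q pq; rewrite !E pq.
case: p => [[a [fa ca]]|] //=; rewrite vlE //.
by case: pselect => /= [_|ng]; rewrite -(ev_trunc a (leqnn (bd t))) // t1.
Qed.

Lemma radical_interpolate k (Q : option hom_point -> A) :
  (forall p q, hom_key k p = hom_key k q -> Q p = Q q) -> Q None = 1 ->
  exists2 z, radical_set A c z & value z = Q.
Proof.
move=> Qk Q1.
pose q (w : nat -> A) : A :=
  xget 1 [set v | exists2 p, hom_key k p = Some w & Q p = v].
have [t [t1 tq]] := interpolate Afin Asimple Acent k q.
exists (ev c (tr k t)).
  by apply: radical_ev => a ga; rewrite ev_tr; apply: t1 => /gen_trunc_gen.
apply: funext => -[[a [fa ca]]|] //=; rewrite vlE // ev_tr.
pose p := Some (exist (fun a => fdom a /\ kle c a) a (conj fa ca)).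
have [ga|nga] := pselect (gen (trunc k a)); last first.
  by rewrite t1 // -Q1; apply: Qk; rewrite hom_keyF.
have pE : hom_key k p = Some (trunc k a) by rewrite hom_keyT.
rewrite tq //; apply: xget_unique; first by exists p.
by move=> v [p' p'E <-]; apply: Qk; rewrite p'E pE.
Qed.

Definition hom_base : stone hom_algebra := principal hom_key_mono None.

Lemma level_set_invariant (z : subloop_loop (radical A c)) v :
  key_invariant hom_key [set p | value (val z) p = v].
Proof.
have [k kP] := radical_value_key (subloop_val z).
by exists k => p q pq /= <-; apply/esym/kP.
Qed.

Definition level_set z v : hom_algebra :=
  in_key_algebra hom_key_mono (level_set_invariant z v).

(** An arbitrary isomorphism [beta] is allowed so as to serve both claims: the back-and-forth one
    for free loops, the identity for countable loops. *)
Lemma radical_boolean_power (d : Order.disp_t) (B : ctbDistrLatticeType d)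
    (x : stone B) (beta : hom_algebra -> B) :
  (forall b b', ((beta b <= beta b') = (b <= b'))%O) ->
  (forall b', exists b, beta b = b') ->
  (forall b, sval hom_base b <-> sval x (beta b)) ->
  loop_isomorphic (subloop_loop (radical A c)) (filtered_boolean_power A x).
Proof.
move=> ble bsurj bx; have [e ue eA] := finite_loop_enum Afin.
have binj : injective beta.
  by move=> b b' bb; apply: le_anti; rewrite -!ble bb lexx.
have bI b b' : beta (b `&` b')%O = (beta b `&` beta b')%O.
  have [i iE] := bsurj (beta b `&` beta b')%O.
  apply: le_anti; rewrite lexI !ble leIl leIr -iE ble lexI -!ble iE.
  by rewrite leIl leIr.
have b0 : beta \bot%O = \bot%O.
  have [i iE] := bsurj \bot%O.
  by apply: le_anti; rewrite le0x andbT -[X in (_ <= X)%O]iE ble le0x.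
have bT : beta \top%O = \top%O.
  have [i iE] := bsurj \top%O.
  by apply: le_anti; rewrite lex1 -[X in (X <= _)%O]iE ble lex1.
have bJ (F : A -> hom_algebra) (r : seq A) :
    beta (\join_(v <- r) F v)%O = (\join_(v <- r) beta (F v))%O.
  have [i iE] := bsurj (\join_(v <- r) beta (F v))%O.
  apply: le_anti; rewrite -iE ble; apply/andP; split.
    by apply/joinsP_seq => v vr _; rewrite -ble iE; exact: joins_sup_seq.
  by rewrite iE; apply/joinsP_seq => v vr _; rewrite ble; exact: joins_sup_seq.
pose mu (n : subloop_loop (radical A c)) v := beta (level_set n v).
apply: (@filtered_boolean_power_iso A e eA _ B x _ mu).
- move=> n v w vw; rewrite /mu -bI -b0; congr beta; apply: val_inj.
  by apply/seteqP; split=> // p [/= -> /vw].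
- move=> n; rewrite /mu -bJ -bT; congr beta; apply/eqP.
  rewrite eq_le lex1 /=; apply/key_leP => p _.
  have : (level_set n (value (val n) p) <= \join_(v <- e) level_set n v)%O.
    exact: joins_sup_seq.
  by move=> /key_leP; apply.
- move=> n m v w; rewrite /mu -bI ble; apply/key_leP => p [/= <- <-].
  exact: valueM.
- move=> n m v w; rewrite /mu -bI ble; apply/key_leP => p [/= <- <-].
  exact: valueL.
- move=> n m v w; rewrite /mu -bI ble; apply/key_leP => p [/= <- <-].
  exact: valueR.
- by move=> n; apply/bx.
- move=> n m nm; apply: val_inj.
  apply: radical_value_inj (subloop_val n) (subloop_val m) _.
  apply: funext => p.
  have /binj /(congr1 val) /= := congr1 (@^~ (value (val m) p)) nm.
  by move=> /(congr1 (@^~ p)) /= ->.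
move=> P' Pd Pc P1.
have /choice[P PE] v : exists b, beta b = P' v by exact: bsurj.
have {PE} PE : P' = beta \o P by apply: funext => v; rewrite /= PE.
rewrite PE /= in Pd Pc P1 *.
have {}Pd p v w : val (P v) p -> val (P w) p -> v = w.
  move=> pv pw; apply: contrapT => /Pd; rewrite -bI -b0 => /binj.
  move=> /(congr1 val) /seteqP[/(_ p) + _]; apply; by split.
have {}Pc p : exists v, val (P v) p.
  have [|v _] := @ultrafilter_joins _ hom_algebra _ e P _
    (svalP (principal hom_key_mono p)); last by exists v.
  by move: Pc; rewrite -bJ -bT => /binj ->.
have {}P1 : val (P 1) None by apply/bx.
have /choice[k kP] v := key_algebraP (P v).
(* A common level at which all the [P v] are invariant; it exists as [A] is finite. *)
pose K := \max_(v <- e) k v.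
have KP v p q : hom_key K p = hom_key K q -> val (P v) p -> val (P v) q.
  move=> pq; apply: kP; apply: hom_key_mono pq.
  by rewrite (@leq_bigmax_seq _ e predT k).
have /choice[Q QP] := Pc.
have [p q pq||z Nz zQ] := @radical_interpolate K Q.
- by apply: (Pd q) => //; apply: KP (QP p).
- exact: Pd (QP None) P1.
exists (in_subloop (S := radical A c) Nz); apply: funext => v.
rewrite /mu /=; congr beta; apply: val_inj => /=; rewrite zQ.
by apply/seteqP; split=> p /= => [<-|pv]; [exact: QP|exact: Pd (QP p) pv].
Qed.

(** Each member is the set where some [t(c)] is 1, or the complement of such a set, according to
    whether it contains the base point; pairs of a boolean and a term are countable. *)
Lemma hom_algebra_enum :
  exists f : nat -> hom_algebra, forall b, exists n, f n = b.
Proof.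
have [[v0 v1] _] := Asimple.
have [v vN1] : exists v : A, v <> 1 by exists v0.
pose S (i : bool * term) : set (option hom_point) :=
  [set p | i.1 <-> value (ev c i.2) p = 1].
have H (b : hom_algebra) : exists i, S i = val b.
  have [k kP] := key_algebraP b.
  pose Q p := if pselect (val b p <-> val b None) then 1 else v.
  have [p q pq||z [t _ tz] zQ] := @radical_interpolate k Q.
  - rewrite /Q; have -> // : val b p = val b q.
    by apply: propext; split; apply: kP.
  - by rewrite /Q; case: pselect => // nb; exfalso; apply: nb.
  exists (`[< val b None >], t); apply/seteqP; rewrite /S /= tz zQ.
  split=> p /=; rewrite asboolE /Q; have := erefl (1 : A);
    have := EM (val b p); move: vN1; by case: pselect => /=; tauto.
have /choice[g gP] := H.
have gi : injective g.
  by move=> b b' /(congr1 S); rewrite !gP => /val_inj.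
have /choice[f fP] n :
    exists b, (exists b', pickle (g b') = n) -> pickle (g b) = n.
  have [[b bn]|nb] := pselect (exists b', pickle (g b') = n); first by exists b.
  by exists \bot%O.
exists f => b; exists (pickle (g b)); apply: gi.
by apply: (pcan_inj pickleK); apply: fP; exists b.
Qed.

Arguments hom_key : simpl never.

Lemma hom_algebra_atomless :
  (forall a : nat -> A, kle c a) -> atomless hom_algebra.
Proof.
move=> call; have [[v0 v0N1] _] := Asimple.
have [e _ eA] := finite_loop_enum Afin.
split; first by move=> /(congr1 val) /seteqP[_ /(_ None)]; apply.
move=> U; rewrite lt0x => /eqP U0.
have [k kU] := key_algebraP U.
have [p Up] : exists p, val U p.
  apply: contrapT => /forallNP nU; apply: U0; apply: val_inj.
  by apply/seteqP; split=> // p /nU.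
have [a Ua] : exists a, val U (Some a).
  case: p Up => [a|] Up; first by exists a.
  (* [k] ones followed by a list of [A]: a generating sequence that level [k] does not distinguish
     from the base point. *)
  pose s i : A := if (i < k)%N then 1 else nth 1 e (i - k).
  have gs : gen s.
    move=> v; exists (Var (k + index v e)).
    by rewrite /= /s ltnNge leq_addr /= addKn nth_index.
  have [b fb sb] := fdom_ex Afin gs.
  exists (exist _ b (conj fb (call b))); apply: kU Up => /=.
  rewrite hom_keyF //= => gb; apply: (@nongen1 A Asimple).
  have := gen_keq Afin (keq_trunc k sb) gb.
  have -> // : trunc k s = fun=> 1.
  by apply: funext => i; rewrite /trunc /s; case: ifP => // ->.
have [l kl gl] : exists2 l, (k <= l)%N & gen (trunc l (sval a)).
  case: (svalP a) => [[ga _] _]; have [m gm] := gen_trunc Afin ga.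
  by exists (maxn k m); [exact: leq_maxl|apply: gen_truncW gm; exact: leq_maxr].
have [v va] : exists v, v <> sval a l.
  have [->|] := pselect (sval a l = 1); first by exists v0.
  by move=> ne; exists 1 => e1; apply: ne.
(* Changing an entry after a generating prefix preserves [fdom]. Level [l] does not see the change
   and level [l.+1] does, so the class of [b] at [l.+1] lies in [U] and omits [a]. *)
pose b i := if i == l then v else sval a i.
have ba : trunc l b = trunc l (sval a).
  by apply/truncP => i il; rewrite /b ltn_eqF.
have fb : fdom b by apply: (fdom_trunc Afin _ gl ba); case: (svalP a).
pose pb : hom_point := exist _ b (conj fb (call b)).
have iV : key_invariant hom_key
    [set q | hom_key l.+1 q = hom_key l.+1 (Some pb)].
  by exists l.+1 => q r qr /=; rewrite qr.
have gl1 : gen (trunc l.+1 (sval a)) by apply: gen_truncW gl.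
have gb1 : gen (trunc l.+1 b).
  by apply: (@gen_truncW _ l) => //; rewrite ba.
pose V : hom_algebra := in_key_algebra hom_key_mono iV.
exists V; apply/andP; split.
  rewrite lt0x; apply/eqP => /(congr1 val) /seteqP[/(_ (Some pb)) + _].
  by apply.
rewrite lt_neqAle; apply/andP; split.
  apply/eqP => VU; have : val V (Some a) by rewrite VU.
  rewrite /V /= hom_keyT // hom_keyT // => -[] /(congr1 (@^~ l)).
  by rewrite /trunc ltnSn /b eqxx => /esym.
apply/key_leP => q /= qb; apply: kU Ua.
apply: (hom_key_mono kl); rewrite hom_keyT // -ba.
rewrite (hom_key_mono (leqnSn l) qb).
by rewrite hom_keyT //= ba.
Qed.

End RadicalBooleanPower.

(** * Varieties, free loops and freeness of the complement *)

Lemma proper_subloop_nongen (A : loopType) (S : subloop A)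
    (a : nat -> subloop_loop S) : subloop_set S <> setT ->
  ~ gen (fun i => val (a i) : A).
Proof.
move=> ST ga; apply: ST; apply/seteqP; split=> // x _.
have [t <-] := ga x; apply: ev_closed (subloopP S) _ => i; exact: subloop_val.
Qed.

Lemma loop_hom_val (L : loopType) (S : subloop L) :
  loop_hom (val : subloop_loop S -> L).
Proof. by split. Qed.

Lemma loop_hom_comp (L M P : loopType) (f : L -> M) (g : M -> P) :
  loop_hom f -> loop_hom g -> loop_hom (g \o f).
Proof.
move=> [f1 fM fl fr] [g1 gM gl gr]; split=> [|x y|x y|x y] /=.
- by rewrite f1 g1.
- by rewrite fM gM.
- by rewrite fl gl.
- by rewrite fr gr.
Qed.

Lemma vanishing_variety (A : loopType) t (M : loopType) : vanishing A t ->
  variety_generated (proper_subloop_of A) M -> holds M t One.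
Proof.
move=> t1 VM; apply: (VM (fun L => holds L t One)); first exact: holds_variety.
move=> _ [S ST ->] u; apply: val_inj.
rewrite (ev_hom u t (loop_hom_val S)) t1 //; exact: proper_subloop_nongen.
Qed.

Lemma variety_generated_variety (P : loopType -> Prop) :
  variety (variety_generated P).
Proof.
split.
- move=> L M f fh fs VL Q vQ PQ; have [QH _ _] := vQ.
  by apply: QH fh fs _; exact: VL.
- by move=> L S VL Q vQ PQ; have [_ QS _] := vQ; apply: QS; exact: VL.
- by move=> I L VL Q vQ PQ; have [_ _ QP] := vQ; apply: QP => i; exact: VL.
Qed.

Lemma proper_variety_sub (A M : loopType) :
  variety_generated (proper_subloop_of A) M ->
  variety_generated (fun L => L = A) M.
Proof.
move=> VM; apply: VM; first exact: variety_generated_variety.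
move=> _ [S _ ->]; have [_ VS _] := variety_generated_variety (fun L => L = A).
by apply: VS => P _; apply.
Qed.

Lemma variety_holds (A C : loopType) s t :
  variety_generated (fun L => L = A) C -> holds A s t -> holds C s t.
Proof.
move=> VC st; apply: (VC (fun L => holds L s t)); first exact: holds_variety.
by move=> _ ->.
Qed.

(** The map to the subloop spanned by [g], followed by the inclusion, is the identity by
    uniqueness. *)
Lemma free_gen (V : loopType -> Prop) (F : loopType) (g : nat -> F) :
  variety V -> free_in V g -> gen g.
Proof.
move=> vV [VF free].
have span_closed : subloop_closed [set x | exists t, ev g t = x].
  split; first by exists One.
  - by move=> _ _ [s <-] [t <-]; exists (Mul s t).
  - by move=> _ _ [s <-] [t <-]; exists (Ldv s t).
  - by move=> _ _ [s <-] [t <-]; exists (Rdv s t).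
pose S := Subloop span_closed.
have gS i : subloop_set S (g i) by exists (Var i).
have VS : V (subloop_loop S) by case: vV => _ + _; apply.
have [f [[fh fg] _]] := free _ VS (fun i => in_subloop (gS i)).
have [h [_ hu]] := free _ VF g.
have idf : id = (val \o f : F -> F).
  transitivity h; first by apply/esym/hu; split=> //; split.
  apply: hu; split; first exact: loop_hom_comp fh (loop_hom_val S).
  by move=> i; rewrite /= fg.
move=> x; have : subloop_set S (val (f x)) by exact: subloop_val.
by rewrite -[val (f x)]/((val \o f) x) -idf.
Qed.

(** The free generators are the components [n i \ g i] of the [g i] in the complement. Homomorphisms
    from [F] to loops in [W] kill the radical, so their restrictions take the prescribed values on
    these. *)
Lemma complement_free (A : loopType) (Afin : finite_set [set: A])
    (Asimple : simple_loop A) (Acent : forall z : A, central z -> z = 1)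
    (F : loopType) (g : nat -> F) (ggen : gen g) :
  free_in (variety_generated (fun L : loopType => L = A)) g ->
  exists h : nat -> subloop_loop (complement Asimple ggen),
    free_in (variety_generated (proper_subloop_of A)) h.
Proof.
move=> [VF free].
have CA s t (st : holds A s t) : ev g s = ev g t := variety_holds VF st g.
have NH1 := @radical_complement _ Afin Asimple Acent _ _ ggen CA.
pose r z := cid2 (radical_decomposition Afin Asimple Acent ggen z).
pose n i := s2val (r (g i)).
have Nn i : radical_set A g (n i) by exact: s2valP (r (g i)).
have /choice[p pP] i : exists p, vanishing A p /\ ev g p = n i.
  by have [p p1 pE] := Nn i; exists p.
pose h i : subloop_loop (complement Asimple ggen) :=
  in_subloop (S := complement Asimple ggen) (s2valP' (r (g i))).
have hE t : val (ev h t) = ev g (subst (fun i => Ldv (p i) (Var i)) t).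
  rewrite (ev_hom _ _ (loop_hom_val _)) ev_subst; congr ev.
  by apply: funext => i; rewrite /= (pP i).2.
have hgen : gen h.
  (* The substitution is trivial at nongenerating sequences, where each [p i] is 1, so [t(h)] and
     [z = t(g)] differ by an element of the radical; both lie in the complement. *)
  move=> z; have [t tz] := ggen (val z); exists t.
  apply: val_inj; apply: rdiv_eq1; apply: NH1.
    rewrite hE -tz.
    apply: (@radical_ev _ _ _ (Rdv (subst (fun i => Ldv (p i) (Var i)) t) t)).
    move=> a na /=; rewrite ev_subst.
    have -> : (fun i => ev a (Ldv (p i) (Var i))) = a.
      by apply: funext => i /=; rewrite (pP i).1 // ldiv1x.
    exact: rdivxx.
  have [_ _ _ HR] := complement_closed Asimple ggen.
  exact: HR (subloop_val (ev h t)) (subloop_val z).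
exists h; split.
  apply: variety_proper_subloops (ggen) _ => q q1 Hq.
  by apply: NH1 => //; exists q.
move=> M WM u; have [f [[fh fg] _]] := free M (proper_variety_sub WM) u.
have f1 z : radical_set A g z -> f z = 1.
  move=> [q q1 <-]; rewrite (ev_hom _ _ fh).
  exact: (vanishing_variety q1 WM (f \o g)).
exists (f \o val); split; first split.
- exact: loop_hom_comp (loop_hom_val _) fh.
- move=> i; have [_ _ fl _] := fh.
  by rewrite /= fl fg f1 ?ldiv1x //; exact: Nn.
move=> f' [f'h f'g]; apply: funext => z; have [t <-] := hgen z.
rewrite (ev_hom _ _ f'h) (ev_hom _ _ (loop_hom_comp (loop_hom_val _) fh)).
congr ev; apply: funext => i /=; have [_ _ fl _] := fh.
by rewrite f'g fl fg f1 ?ldiv1x //; exact: Nn.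
Qed.

Theorem corollary5p1 (A : loopType)
    (A_finite : finite_set [set: A])
    (A_simple : simple_loop A)
    (A_nonabelian : ~ abelian_loop A) :
  let V := variety_generated (fun L : loopType => L = A) in
  let W := variety_generated (proper_subloop_of A) in
  (forall (F : loopType) (g : nat -> F), free_in V g ->
     exists N H : subloop F,
       [/\ normal_subloop N,
           forall (d : Order.disp_t) (B : ctbDistrLatticeType d) (x : stone B),
             countable [set: B] -> atomless B ->
             loop_isomorphic (subloop_loop N) (filtered_boolean_power A x),
           exists (G : loopType) (h : nat -> G),
             free_in W h /\ loop_isomorphic (subloop_loop H) G,
           N `&` H = [set 1] &
           [set n * h | n in N & h in H] = [set: F]])
  /\
  (forall C : loopType, V C -> countable [set: C] ->
     exists (d : Order.disp_t) (B : ctbDistrLatticeType d) (x : stone B)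
         (N H : subloop C),
       [/\ loop_isomorphic (subloop_loop N) (filtered_boolean_power A x),
           W (subloop_loop H) &
           split_extension N H]).
Proof.
move=> V W; have Acent := simple_central1 A_simple A_nonabelian.
split.
  move=> F g Fg; have [VF free] := Fg.
  have ggen : gen g := free_gen (variety_generated_variety _) Fg.
  have CA s t (st : holds A s t) : ev g s = ev g t := variety_holds VF st g.
  (* By freeness every sequence of [A] is the image of [g] under a homomorphism. *)
  have call (a : nat -> A) : kle g a.
    have VA : V A by move=> P _; apply.
    have [f [[fh fg] _]] := free A VA a; move=> s t st.
    have -> : a = f \o g by apply: funext => i; rewrite /= fg.
    by rewrite -!(ev_hom _ _ fh) st.
  exists (radical A g), (complement A_simple ggen); split.
  - exact: radical_normal ggen.
  - move=> d B x cB aB.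
    have [eB' eB'P] := countable_enum \bot%O cB.
    have [eB eBP] := hom_algebra_enum A_finite A_simple Acent ggen.
    have aB' := hom_algebra_atomless A_finite A_simple call.
    have [beta [ble bsurj bx]] :=
      pointed_boolean_iso (hom_base A g) x aB' aB eBP eB'P.
    exact: (radical_boolean_power A_finite A_simple Acent ggen CA ble bsurj bx).
  - have [h hfree] := complement_free A_finite A_simple Acent ggen Fg.
    exists (subloop_loop (complement A_simple ggen)), h; split=> //.
    by exists id; [split|exists id].
  - apply/seteqP; split=> z.
      case=> Nz Hz.
      exact: (@radical_complement _ A_finite A_simple Acent _ _ ggen CA z).
    move=> ->; split; first by case: (subloopP (radical A g)).
    by case: (subloopP (complement A_simple ggen)).
  - apply/seteqP; split=> // z _.
    have [n Nn Hn] := radical_decomposition A_finite A_simple Acent ggen z.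
    by exists n => //; exists (ldiv n z) => //; rewrite mul_ldiv.
(* An enumeration of all of [C] serves as the generating sequence. *)
move=> C VC cC; have [c cP] := countable_enum 1 cC.
have cgen : gen c by move=> z; have [n <-] := cP z; exists (Var n).
have CA s t (st : holds A s t) : ev c s = ev c t := variety_holds VC st c.
exists set_display, (hom_algebra A c), (hom_base A c).
exists (radical A c), (complement A_simple cgen).
split.
- apply: (radical_boolean_power A_finite A_simple Acent cgen CA (beta := id));
    rewrite // => b.
  by exists b.
- apply: variety_proper_subloops (cgen) _ => q q1 Hq.
  by apply: (radical_complement A_finite A_simple Acent CA _ Hq); exists q.
- split; first exact: radical_normal cgen.
  exact (radical_transversal A_finite A_simple Acent cgen CA).
Qed.
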